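(* Let $0\leq\beta<1$, $-\pi/2<\alpha<\pi/2$, and let $f\in\mathcal{SP}^{0}_{\alpha}(\beta)$. Then the pre-Schwarzian norm satisfies $$\|P_f\|\leq 2(1-\beta)\cos\alpha.$$ The inequality is sharp (for given $\alpha,\beta$ the bound cannot be replaced by a smaller one).
   Context: $\mathbb{D}=\{z\in\mathbb{C}:|z|<1\}$. $\mathcal{A}$ is the class of analytic functions $f$ on $\mathbb{D}$ with $f(0)=0$ and $f'(0)=1$. For $-\pi/2<\alpha<\pi/2$ and $0\leq\beta<1$, $\mathcal{SP}_\alpha(\beta)$ is the class of $f\in\mathcal{A}$ (with $f'(z)\neq 0$ on $\mathbb{D}$) such that $\mathrm{Re}\left\{e^{i\alpha}\left(1+\frac{zf''(z)}{f'(z)}\right)\right\}>\beta\cos\alpha$ for all $z\in\mathbb{D}$. Moreover $\mathcal{SP}^{0}_\alpha(\beta)=\{f\in\mathcal{SP}_\alpha(\beta): f''(0)=0\}$. The pre-Schwarzian derivative is $P_f=f''/f'$ and its norm is $\|P_f\|=\sup_{z\in\mathbb{D}}(1-|z|^2)|P_f(z)|$. *)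

(* Defs.v *)
From Stdlib Require Import Reals.
From Coquelicot Require Import Coquelicot.

Local Open Scope R_scope.

Definition disc (z : C) : Prop := Cmod z < 1.

(* Analytic: locally the sum of a convergent complex power series.  The radius
   is existential and [disc] is open, so only the values of [f] on the disc
   matter. *)
Definition analytic_on_disc (f : C -> C) : Prop :=
  forall z0 : C, disc z0 ->
  exists (r : posreal) (a : nat -> C), forall z : C, Cmod (z - z0)%C < r ->
    @is_pseries C_AbsRing C_NormedModule a (z - z0)%C (f z).

(* [C_derive] is total, and computes the limit of difference quotients along
   the real direction; it is the complex derivative wherever that exists
   ([is_C_derive_unique]).  An analytic [f] has complex derivatives of all
   orders on the disc, so [C_derive f] and [C_derive (C_derive f)] are the
   genuine f' and f'' there. *)
Definition class_A (f : C -> C) : Prop :=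
  analytic_on_disc f /\ f (RtoC 0) = RtoC 0 /\ C_derive f (RtoC 0) = RtoC 1.

Definition pre_Schwarzian (f : C -> C) (z : C) : C :=
  (C_derive (C_derive f) z / C_derive f z)%C.

Definition cexpi (alpha : R) : C := (cos alpha, sin alpha).

Definition SP (alpha beta : R) (f : C -> C) : Prop :=
  class_A f /\
  (forall z : C, disc z -> C_derive f z <> RtoC 0) /\
  (forall z : C, disc z ->
     Re (cexpi alpha *
         (1 + z * C_derive (C_derive f) z / C_derive f z))%C
     > beta * cos alpha).

Definition SP0 (alpha beta : R) (f : C -> C) : Prop :=
  SP alpha beta f /\ C_derive (C_derive f) (RtoC 0) = RtoC 0.

(* A supremum in [Rbar]: it is [p_infty] when the set is unbounded. *)
Definition pre_Schwarzian_norm (f : C -> C) : Rbar :=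
  Lub_Rbar (fun x : R => exists z : C, disc z /\
    x = (1 - Cmod z ^ 2) * Cmod (pre_Schwarzian f z)).

(* Main.v *)
Require Import Defs.
From Stdlib Require Import Reals Lra Lia ClassicalEpsilon.
From Coquelicot Require Import Coquelicot.
Local Open Scope R_scope.

(** The bound is a Schwarz lemma of order two.  Write [c = (1 - beta) cos alpha],
    [e = exp (i alpha)] and [v (z) = e z f''(z) / f'(z)].  The hypothesis says
    [Re v > - c], so [v / (v + 2 c)] maps the disc into itself; as [f''(0) = 0],
    it vanishes to order two at [0], and
    [W (z) = v / (z^2 (v + 2 c)) = e q / (z^2 e q + 2 c f')], where
    [q (z) = f''(z) / z], has no singularity.  On the circle of radius [rho] we
    have [|W| <= 1 / rho^2]; the maximum modulus principle and [rho -> 1] give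
    [|W| <= 1], that is [|q| <= |z|^2 |q| + 2 c |f'|].  Hence
    [(1 - |z|^2) |f'' / f'| <= 2 c |z| <= 2 c] ([SP0_pre_Schwarzian_bound]).

    For sharpness take [f' (z) = (1 - z^2)^(- kappa)] with
    [kappa = c exp (- i alpha)]: then [f'' / f' = 2 kappa z / (1 - z^2)], the
    weighted modulus at a real [x] is [2 c x], and it tends to [2 c]
    ([extremal_SP0], [extremal_pre_Schwarzian]).  To have [f] as a power series
    from the start, it is defined by the coefficient recursion equivalent to
    [(1 - z^2) f'' = 2 kappa z f'].

    The function theory behind this rests on two tools.  Recentring
    ([Cps_recentre]) expands a power series around any other point of its disc;
    the new linear coefficient is the termwise derivative, so it yields at once
    that power series are analytic and that derivatives of analytic functions
    are ([Cps_C_derive]).  Second-order Taylor expansions with a cubic error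
    ([jet]) are all that the maximum principle needs: at an interior maximum of
    [Re g + eps |z|^2], averaging over the four points [z +- t], [z +- i t]
    removes the linear and quadratic terms of [Re g] and leaves the gain
    [eps t^2] ([max_principle_Re]).  Since jets are stable under sums, products
    and inverses, [W] is covered without knowing that quotients of power series
    are power series. *)

(** * Complex series and power series *)

Definition Cseries (u : nat -> C) (l : C) : Prop :=
  @is_series C_AbsRing C_NormedModule u l.

Definition Csum (u : nat -> C) (N : nat) : C :=
  @sum_n (NormedModule.AbelianMonoid C_AbsRing C_NormedModule) u N.

Lemma Csum_0 (u : nat -> C) : Csum u 0 = u 0%nat.
Proof. apply (sum_O (G := NormedModule.AbelianMonoid C_AbsRing C_NormedModule)). Qed.

Lemma Csum_S (u : nat -> C) (N : nat) : Csum u (S N) = (Csum u N + u (S N))%C.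
Proof. apply (sum_Sn (G := NormedModule.AbelianMonoid C_AbsRing C_NormedModule)). Qed.

Definition Cps (a : nat -> C) (z l : C) : Prop :=
  Cseries (fun n => a n * z ^ n)%C l.

Lemma Cps_is_pseries (a : nat -> C) (z l : C) :
  Cps a z l <-> @is_pseries C_AbsRing C_NormedModule a z l.
Proof.
  unfold Cps, Cseries, is_pseries.
  assert (E : forall n, (a n * z ^ n)%C = @scal C_AbsRing C_NormedModule (@pow_n C_Ring z n) (a n)).
  { intros n. change (a n * z ^ n = @pow_n C_Ring z n * a n)%C. apply Cmult_comm. }
  split; apply is_series_ext; intros n; [|symmetry]; apply E.
Qed.

Lemma Cseries_ext (u v : nat -> C) (l : C) :
  (forall n, u n = v n) -> Cseries u l -> Cseries v l.
Proof. apply is_series_ext. Qed.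

Lemma Cseries_unique (u : nat -> C) (l l' : C) :
  Cseries u l -> Cseries u l' -> l = l'.
Proof.
  intros H H'.
  exact (filterlim_locally_unique (V := C_NormedModule) _ _ _ H H').
Qed.

Lemma Cseries_plus (u v : nat -> C) (l m : C) :
  Cseries u l -> Cseries v m -> Cseries (fun n => u n + v n)%C (l + m)%C.
Proof. apply (is_series_plus (V := C_NormedModule)). Qed.

Lemma Cseries_scal (c : C) (u : nat -> C) (l : C) :
  Cseries u l -> Cseries (fun n => c * u n)%C (c * l)%C.
Proof. apply (is_series_scal (V := C_NormedModule)). Qed.

Lemma Cseries_minus (u v : nat -> C) (l m : C) :
  Cseries u l -> Cseries v m -> Cseries (fun n => u n - v n)%C (l - m)%C.
Proof.
  intros Hu Hv.
  apply (Cseries_ext (fun n => u n + (-(1)) * v n)%C); [intros n; ring|].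
  replace (l - m)%C with (l + (-(1)) * m)%C by ring.
  now apply Cseries_plus, Cseries_scal.
Qed.

(** Horner step: pulls the constant term and one factor [z] out of the series. *)
Lemma Cps_S (a : nat -> C) (z l : C) :
  Cps (fun n => a (S n)) z l -> Cps a z (a 0%nat + z * l)%C.
Proof.
  intros H. unfold Cps, Cseries.
  apply (is_series_decr_1 (V := C_NormedModule)).
  match goal with |- is_series _ ?x => replace x with (z * l)%C end.
  - apply (Cseries_ext (fun n => z * (a (S n) * z ^ n))%C).
    + intros n. rewrite Cpow_S. ring.
    + now apply Cseries_scal.
  - change (z * l = (a 0%nat + z * l) + - (a 0%nat * 1))%C. ring.
Qed.

Lemma Cseries_Cmod_le (u : nat -> C) (l : C) (b : nat -> R) (B : R) :
  Cseries u l -> is_series b B -> (forall n, Cmod (u n) <= b n) -> Cmod l <= B.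
Proof.
  intros Hu Hb Hle.
  assert (H1 : filterlim (fun n => norm (sum_n u n)) eventually (locally (norm (l : C_NormedModule)))).
  { eapply filterlim_comp; [exact Hu|]. apply (filterlim_norm (V := C_NormedModule)). }
  change (Rbar_le (norm (l : C_NormedModule)) B).
  eapply (filterlim_le (F := eventually)); [|exact H1|exact Hb].
  exists 0%nat. intros n _.
  eapply Rle_trans; [apply (norm_sum_n_m (V := C_NormedModule))|].
  apply sum_n_m_le. intros k. apply Hle.
Qed.

Lemma Cseries_of_abs (u : nat -> C) (b : nat -> R) :
  (forall n, Cmod (u n) <= b n) -> ex_series b -> exists l, Cseries u l.
Proof.
  intros Hle Hb.
  exact (ex_series_le (V := C_CompleteNormedModule) u b Hle Hb).
Qed.

(** The form of convergence suited to [tcoef_remainder], where the remainder after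
    [N] terms carries a factor [t ^ N]. *)
Lemma Cseries_of_tail (u : nat -> C) (l : C) (A t : R) :
  0 <= t < 1 -> (forall N, Cmod (Csum u N - l)%C <= A * t ^ N) -> Cseries u l.
Proof.
  intros Ht H.
  assert (HA : 0 <= A).
  { specialize (H 0%nat). simpl in H. pose proof (Cmod_ge_0 (Csum u 0 - l)%C). lra. }
  apply (filterlim_locally_ball_norm (U := C_NormedModule) (Csum u) l).
  intros eps.
  assert (He : 0 < eps / (A + 1)).
  { apply Rdiv_lt_0_compat; [apply cond_pos|lra]. }
  destruct (pow_lt_1_zero t) with (y := eps / (A + 1)) as [N HN]; [rewrite Rabs_pos_eq; lra|exact He|].
  exists N. intros n Hn.
  change (Cmod (Csum u n - l)%C < eps).
  eapply Rle_lt_trans; [apply H|].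
  specialize (HN n Hn). rewrite Rabs_pos_eq in HN by (apply pow_le; lra).
  apply Rle_lt_trans with (A * (eps / (A + 1))).
  { apply Rmult_le_compat_l; lra. }
  pose proof (cond_pos eps).
  apply Rmult_lt_reg_r with (A + 1); [lra|].
  replace (A * (eps / (A + 1)) * (A + 1)) with (A * eps) by (field; lra). lra.
Qed.

Lemma Cps_at_0 (a : nat -> C) : Cps a (RtoC 0) (a 0%nat).
Proof.
  apply (Cseries_of_tail _ _ 0 0); [lra|]. intros N.
  replace (Csum _ N) with (a 0%nat).
  - replace (a 0%nat - a 0%nat)%C with (RtoC 0) by ring. rewrite Cmod_0. lra.
  - induction N as [|N IH].
    + rewrite Csum_0. simpl. ring.
    + rewrite Csum_S, <- IH, Cpow_S. ring.
Qed.

Definition Cps_on (r : R) (a : nat -> C) : Prop :=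
  forall z, Cmod z < r -> exists l, Cps a z l.

(** Abel's lemma: the terms at a radius strictly between [s] and [r] are bounded,
    so the series at radius [s] is dominated by a geometric one. *)
Lemma Cps_on_abs (r : R) (a : nat -> C) (s : R) :
  Cps_on r a -> 0 <= s < r -> ex_series (fun n => Cmod (a n) * s ^ n).
Proof.
  intros Ha Hs.
  set (s' := (s + r) / 2).
  destruct (Ha (RtoC s')) as [l Hl].
  { rewrite Cmod_R, Rabs_pos_eq; unfold s'; lra. }
  assert (Hb : exists K, forall n, Cmod (a n) * s' ^ n <= K).
  { destruct (filterlim_bounded (V := C_NormedModule) (Csum (fun n => a n * RtoC s' ^ n)%C)) as [M HM].
    { exists l. exact Hl. }
    exists (2 * M). intros n.
    replace (Cmod (a n) * s' ^ n) with (Cmod (a n * RtoC s' ^ n)%C).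
    2:{ rewrite Cmod_mult, Cmod_pow, Cmod_R, Rabs_pos_eq; [reflexivity|unfold s'; lra]. }
    assert (HM' : forall k, Cmod (Csum (fun n => a n * RtoC s' ^ n)%C k) <= M) by exact HM.
    destruct n as [|n].
    - specialize (HM' 0%nat). rewrite Csum_0 in HM'.
      pose proof (Cmod_ge_0 (a 0%nat * RtoC s' ^ 0)%C). lra.
    - pose proof (HM' n) as H1. pose proof (HM' (S n)) as H2.
      rewrite Csum_S in H2.
      set (p := Csum _ n) in *. set (q := (a (S n) * RtoC s' ^ S n)%C) in *.
      replace q with ((p + q) + - p)%C by ring.
      eapply Rle_trans; [apply Cmod_triangle|]. rewrite Cmod_opp. lra. }
  destruct Hb as [K HK].
  assert (Hs' : 0 < s') by (unfold s'; lra).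
  assert (Hq : 0 <= s / s' < 1).
  { split; [apply Rdiv_le_0_compat; lra|]. apply Rlt_div_l; unfold s'; lra. }
  apply (ex_series_le (V := R_CompleteNormedModule) _ (fun n => K * (s / s') ^ n)).
  - intros n. change (norm (V := R_NormedModule)) with Rabs. simpl.
    change (Rabs (Cmod (a n) * s ^ n) <= K * (s / s') ^ n).
    rewrite Rabs_pos_eq by (apply Rmult_le_pos; [apply Cmod_ge_0|apply pow_le; lra]).
    replace (s ^ n) with (s' ^ n * (s / s') ^ n).
    2:{ rewrite <- Rpow_mult_distr. f_equal. field. lra. }
    rewrite <- Rmult_assoc. apply Rmult_le_compat_r; [apply pow_le; lra|apply HK].
  - apply (ex_series_scal_l (V := R_NormedModule)), ex_series_geom. rewrite Rabs_pos_eq; lra.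
Qed.

Lemma Cps_on_of_abs (r : R) (a : nat -> C) :
  (forall s, 0 <= s < r -> ex_series (fun n => Cmod (a n) * s ^ n)) -> Cps_on r a.
Proof.
  intros H z Hz.
  apply (Cseries_of_abs _ (fun n => Cmod (a n) * Cmod z ^ n)).
  - intros n. rewrite Cmod_mult, Cmod_pow. apply Rle_refl.
  - apply H. split; [apply Cmod_ge_0|exact Hz].
Qed.

(** * Recentring a power series *)

(** The coefficient of [h ^ k] in [(z + h) ^ n], by Pascal's rule; the recursion
    makes it vanish for [k > n] and spares all binomial identities. *)
Fixpoint tcoef (z : C) (n k : nat) : C :=
  match n, k with
  | 0, 0 => RtoC 1
  | 0, S _ => RtoC 0
  | S n', 0 => (z * tcoef z n' 0)%C
  | S n', S k' => (z * tcoef z n' (S k') + tcoef z n' k')%C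
  end.

Lemma tcoef_0 z n : tcoef z n 0 = (z ^ n)%C.
Proof.
  induction n as [|n IH]; [reflexivity|]. simpl tcoef. now rewrite IH, Cpow_S.
Qed.

Lemma tcoef_1 z n : tcoef z (S n) 1 = (RtoC (INR (S n)) * z ^ n)%C.
Proof.
  induction n as [|n IH].
  - simpl. ring.
  - change (tcoef z (S (S n)) 1) with (z * tcoef z (S n) 1 + tcoef z (S n) 0)%C.
    rewrite IH, tcoef_0, (S_INR (S n)), RtoC_plus, !Cpow_S. ring.
Qed.

Lemma tcoef_bound z n k s : 0 <= s -> Cmod (tcoef z n k) * s ^ k <= (Cmod z + s) ^ n.
Proof.
  intros Hs. pose proof (Cmod_ge_0 z) as Hz. revert k.
  induction n as [|n IH]; intros [|k].
  - simpl. rewrite Cmod_1. lra.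
  - simpl. rewrite Cmod_0. lra.
  - simpl tcoef. rewrite Cmod_mult. specialize (IH 0%nat). simpl in IH |- *.
    assert (0 <= (Cmod z + s) ^ n) by (apply pow_le; lra). nra.
  - simpl tcoef.
    pose proof (IH (S k)) as H1. pose proof (IH k) as H2.
    pose proof (Cmod_triangle (z * tcoef z n (S k)) (tcoef z n k)) as H3.
    rewrite Cmod_mult in H3.
    assert (0 <= s ^ S k) by (apply pow_le; lra).
    apply Rle_trans with ((Cmod z * Cmod (tcoef z n (S k)) + Cmod (tcoef z n k)) * s ^ S k).
    { apply Rmult_le_compat_r; assumption. }
    simpl pow in *. nra.
Qed.

Lemma tcoef_sum_step z h n K :
  Csum (fun k => tcoef z (S n) k * h ^ k)%C (S K) =
  (z * Csum (fun k => tcoef z n k * h ^ k) (S K) + h * Csum (fun k => tcoef z n k * h ^ k) K)%C.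
Proof.
  induction K as [|K IH].
  - rewrite !Csum_S, !Csum_0. simpl tcoef. simpl. ring.
  - rewrite Csum_S, IH, (Csum_S (fun k => tcoef z n k * h ^ k)%C (S K)),
      (Csum_S (fun k => tcoef z n k * h ^ k)%C K).
    simpl tcoef. rewrite (Cpow_S h (S K)). ring.
Qed.

(** Writing [E (K, n)] for the binomial expansion of [(z + h) ^ n] deprived of its
    terms of degree at most [K], Pascal's rule gives
    [E (K + 1, n + 1) = z E (K + 1, n) + h E (K, n)].  Each step in [K] costs a factor
    [h], at most [t s], so induction on [n] gives the factor
    [t ^ (K + 1)], uniformly in [n]. *)
Lemma tcoef_remainder z h s t n K :
  0 <= s -> 0 <= t <= 1 -> Cmod h <= t * s ->
  Cmod ((z + h) ^ n - Csum (fun k => tcoef z n k * h ^ k) K)%C <= (Cmod z + s) ^ n * t ^ S K.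
Proof.
  intros Hs Ht Hh. pose proof (Cmod_ge_0 z) as Hz.
  assert (Hzh : Cmod (z + h) <= Cmod z + s).
  { pose proof (Cmod_triangle z h). nra. }
  assert (Hp : forall n, Cmod ((z + h) ^ n) <= (Cmod z + s) ^ n).
  { intros m. rewrite Cmod_pow. apply pow_incr. split; [apply Cmod_ge_0|exact Hzh]. }
  assert (P : forall n, 0 <= (Cmod z + s) ^ n) by (intros m; apply pow_le; lra).
  revert K. induction n as [|n IH]; intros K.
  - replace (Csum _ K) with (RtoC 1).
    + simpl (_ ^ 0)%C. replace (1 - 1)%C with (RtoC 0) by ring. rewrite Cmod_0.
      apply Rmult_le_pos; [apply P|apply pow_le; lra].
    + induction K as [|K IHK]; [rewrite Csum_0; simpl; ring|].
      rewrite Csum_S, <- IHK. change (RtoC 1 = 1 + 0 * h ^ S K)%C. ring.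
  - destruct K as [|K].
    + rewrite Csum_0, tcoef_0. specialize (IH 0%nat). rewrite Csum_0, tcoef_0 in IH.
      replace ((z + h) ^ S n - z ^ S n * h ^ 0)%C
        with (z * ((z + h) ^ n - z ^ n * h ^ 0) + h * (z + h) ^ n)%C
        by (rewrite !Cpow_S; simpl (h ^ 0)%C; ring).
      eapply Rle_trans; [apply Cmod_triangle|]. rewrite !Cmod_mult.
      specialize (Hp n). specialize (P n).
      set (X := Cmod ((z + h) ^ n)) in *. set (Y := Cmod (_ - _)%C) in *.
      pose proof (Cmod_ge_0 h).
      assert (0 <= X) by apply Cmod_ge_0.
      assert (0 <= Y) by apply Cmod_ge_0.
      simpl pow in *.
      apply Rle_trans with (Cmod z * ((Cmod z + s) ^ n * (t * 1)) + (t * s) * (Cmod z + s) ^ n).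
      { apply Rplus_le_compat; apply Rmult_le_compat; lra. }
      lra.
    + rewrite tcoef_sum_step.
      pose proof (IH (S K)) as H1. pose proof (IH K) as H2.
      replace ((z + h) ^ S n - (z * Csum (fun k : nat => (tcoef z n k * h ^ k)%C) (S K) +
        h * Csum (fun k : nat => (tcoef z n k * h ^ k)%C) K))%C
      with (z * ((z + h) ^ n - Csum (fun k : nat => (tcoef z n k * h ^ k)%C) (S K)) +
            h * ((z + h) ^ n - Csum (fun k : nat => (tcoef z n k * h ^ k)%C) K))%C
        by (rewrite Cpow_S; ring).
      eapply Rle_trans; [apply Cmod_triangle|]. rewrite !Cmod_mult.
      apply Rle_trans with (Cmod z * ((Cmod z + s) ^ n * t ^ S (S K)) +
                            (t * s) * ((Cmod z + s) ^ n * t ^ S K)).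
      { apply Rplus_le_compat; apply Rmult_le_compat; try assumption; try apply Rle_refl; apply Cmod_ge_0. }
      simpl pow. lra.
Qed.

(** For fixed [K], the terms of degree at most [K] in [h] of all the [(z + h) ^ n]
    are finitely many convergent series in [n], and [tcoef_remainder] makes what is
    left geometrically small in [K]: no exchange of infinite sums occurs. *)
Lemma Cps_recentre (r : R) (a : nat -> C) (z : C) :
  Cps_on r a -> Cmod z < r ->
  exists b : nat -> C,
    (forall k, Cseries (fun n => a n * tcoef z n k)%C (b k)) /\
    (forall h l, Cmod h < r - Cmod z -> Cps a (z + h)%C l -> Cps b h l).
Proof.
  intros Ha Hz. pose proof (Cmod_ge_0 z) as Hz0.
  assert (Hex : forall k, exists b, Cseries (fun n => a n * tcoef z n k)%C b).
  { intros k. set (s := (r - Cmod z) / 2).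
    assert (Hs : 0 < s) by (unfold s; lra).
    apply (Cseries_of_abs _ (fun n => / s ^ k * (Cmod (a n) * (Cmod z + s) ^ n))).
    - intros n. rewrite Cmod_mult.
      pose proof (tcoef_bound z n k s (Rlt_le _ _ Hs)) as Hb.
      assert (Hsk : 0 < s ^ k) by now apply pow_lt.
      replace (Cmod (a n) * Cmod (tcoef z n k))
        with (/ s ^ k * (Cmod (a n) * (Cmod (tcoef z n k) * s ^ k))) by (field; lra).
      apply Rmult_le_compat_l; [apply Rlt_le, Rinv_0_lt_compat, Hsk|].
      apply Rmult_le_compat_l; [apply Cmod_ge_0|exact Hb].
    - apply (ex_series_scal_l (V := R_NormedModule)). apply Cps_on_abs with r; [exact Ha|]. unfold s; lra. }
  exists (fun k => proj1_sig (constructive_indefinite_description _ (Hex k))).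
  assert (Hb : forall k, Cseries (fun n => a n * tcoef z n k)%C
     (proj1_sig (constructive_indefinite_description _ (Hex k)))).
  { intros k. apply proj2_sig. }
  set (b := fun k => _) in *. split; [exact Hb|].
  intros h l Hh Hl.
  set (s := (Cmod h + (r - Cmod z)) / 2).
  pose proof (Cmod_ge_0 h) as Hh0.
  assert (Hs : 0 < s) by (unfold s; lra).
  set (t := Cmod h / s).
  assert (Ht : 0 <= t < 1).
  { unfold t; split; [apply Rdiv_le_0_compat; lra|]. apply Rlt_div_l; unfold s; lra. }
  assert (Hts : Cmod h <= t * s) by (apply Req_le; unfold t; field; lra).
  destruct (Cps_on_abs r a (Cmod z + s) Ha) as [A HA]; [unfold s; lra|].
  assert (HT : forall N, Cseries (fun n => a n * Csum (fun k => tcoef z n k * h ^ k) N)%C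
                           (Csum (fun k => b k * h ^ k)%C N)).
  { induction N as [|N IH].
    - rewrite Csum_0. apply (Cseries_ext (fun n => h ^ 0 * (a n * tcoef z n 0))%C).
      + intros n. rewrite Csum_0. ring.
      + rewrite Cmult_comm. now apply Cseries_scal.
    - rewrite Csum_S.
      apply (Cseries_ext (fun n => a n * Csum (fun k => tcoef z n k * h ^ k) N +
                h ^ S N * (a n * tcoef z n (S N)))%C).
      + intros n. rewrite Csum_S. ring.
      + apply Cseries_plus; [exact IH|]. rewrite Cmult_comm. now apply Cseries_scal. }
  apply Cseries_of_tail with (A := A * t) (t := t); [exact Ht|].
  intros N.
  replace (Csum (fun n : nat => (b n * h ^ n)%C) N - l)%C
    with (- (l - Csum (fun n : nat => (b n * h ^ n)%C) N))%C by ring.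
  rewrite Cmod_opp.
  eapply Cseries_Cmod_le with (b := fun n => (t ^ S N) * (Cmod (a n) * (Cmod z + s) ^ n)).
  - apply Cseries_minus; [exact Hl|apply HT].
  - replace (A * t * t ^ N) with (t ^ S N * A) by (simpl; ring).
    apply (is_series_scal (V := R_NormedModule)). exact HA.
  - intros n. cbv beta.
    replace (a n * (z + h) ^ n - a n * Csum (fun k : nat => (tcoef z n k * h ^ k)%C) N)%C
      with (a n * ((z + h) ^ n - Csum (fun k : nat => (tcoef z n k * h ^ k)%C) N))%C by ring.
    rewrite Cmod_mult.
    apply Rle_trans with (Cmod (a n) * ((Cmod z + s) ^ n * t ^ S N)).
    + apply Rmult_le_compat_l; [apply Cmod_ge_0|]. apply tcoef_remainder; lra.
    + lra.
Qed.

(** * Second-order jets *)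

Lemma Cmod_plus_le (x y : C) (A B : R) :
  Cmod x <= A -> Cmod y <= B -> Cmod (x + y) <= A + B.
Proof. intros Hx Hy. pose proof (Cmod_triangle x y). lra. Qed.

Lemma Cmod_mult_le (x y : C) (A B : R) :
  Cmod x <= A -> Cmod y <= B -> Cmod (x * y) <= A * B.
Proof.
  intros Hx Hy. rewrite Cmod_mult.
  apply Rmult_le_compat; try assumption; apply Cmod_ge_0.
Qed.

Ltac Cmod_bound :=
  repeat first [eassumption | apply Cmod_plus_le | apply Cmod_mult_le | apply Rle_refl].

(** Second-order Taylor expansion with a cubic remainder, in Horner form so that
    the algebra of jets is checked by [ring]. *)
Definition jet (g : C -> C) (z a0 a1 a2 : C) : Prop :=
  exists K d : R, 0 < d /\ forall h : C, Cmod h < d ->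
    exists rho : C, Cmod rho <= K /\
      g (z + h)%C = (a0 + h * (a1 + h * (a2 + h * rho)))%C.

Lemma jet_value g z a0 a1 a2 : jet g z a0 a1 a2 -> g z = a0.
Proof.
  intros (K & d & Hd & H).
  destruct (H (RtoC 0)) as (rho & _ & E); [now rewrite Cmod_0|].
  rewrite Cplus_0_r in E. rewrite E. ring.
Qed.

Lemma jet_ext g k z a0 a1 a2 e :
  0 < e -> (forall h, Cmod h < e -> g (z + h)%C = k (z + h)%C) ->
  jet g z a0 a1 a2 -> jet k z a0 a1 a2.
Proof.
  intros He Hgk (K & d & Hd & H).
  exists K, (Rmin d e). split; [now apply Rmin_pos|].
  intros h Hh. rewrite <- Hgk by (eapply Rlt_le_trans; [exact Hh|apply Rmin_r]).
  apply H. eapply Rlt_le_trans; [exact Hh|apply Rmin_l].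
Qed.

Lemma jet_const c z : jet (fun _ => c) z c (RtoC 0) (RtoC 0).
Proof.
  exists 0, 1. split; [lra|]. intros h _. exists (RtoC 0).
  rewrite Cmod_0. split; [lra|ring].
Qed.

Lemma jet_id z : jet (fun w => w) z z (RtoC 1) (RtoC 0).
Proof.
  exists 0, 1. split; [lra|]. intros h _. exists (RtoC 0).
  rewrite Cmod_0. split; [lra|ring].
Qed.

Lemma jet_plus g k z a0 a1 a2 b0 b1 b2 :
  jet g z a0 a1 a2 -> jet k z b0 b1 b2 ->
  jet (fun w => g w + k w)%C z (a0 + b0)%C (a1 + b1)%C (a2 + b2)%C.
Proof.
  intros (K & d & Hd & H) (K' & d' & Hd' & H').
  exists (K + K'), (Rmin d d'). split; [now apply Rmin_pos|].
  intros h Hh.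
  destruct (H h) as (rho & Hr & E); [eapply Rlt_le_trans; [exact Hh|apply Rmin_l]|].
  destruct (H' h) as (rho' & Hr' & E'); [eapply Rlt_le_trans; [exact Hh|apply Rmin_r]|].
  exists (rho + rho')%C. split; [now apply Cmod_plus_le|].
  rewrite E, E'. ring.
Qed.

Lemma jet_mult g k z a0 a1 a2 b0 b1 b2 :
  jet g z a0 a1 a2 -> jet k z b0 b1 b2 ->
  jet (fun w => g w * k w)%C z (a0 * b0)%C (a0 * b1 + a1 * b0)%C
    (a0 * b2 + a1 * b1 + a2 * b0)%C.
Proof.
  intros (K & d & Hd & H) (K' & d' & Hd' & H').
  eexists _, (Rmin 1 (Rmin d d')). split; [repeat apply Rmin_pos; lra|].
  intros h Hh.
  assert (Hh1 : Cmod h <= 1).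
  { apply Rlt_le. eapply Rlt_le_trans; [exact Hh|apply Rmin_l]. }
  assert (Hh2 : Cmod h < Rmin d d').
  { eapply Rlt_le_trans; [exact Hh|apply Rmin_r]. }
  destruct (H h) as (rho & Hr & E); [eapply Rlt_le_trans; [exact Hh2|apply Rmin_l]|].
  destruct (H' h) as (rho' & Hr' & E'); [eapply Rlt_le_trans; [exact Hh2|apply Rmin_r]|].
  exists (a0 * rho' + (a1 * (b2 + h * rho') + (a2 * (b1 + h * (b2 + h * rho'))
          + rho * (b0 + h * (b1 + h * (b2 + h * rho'))))))%C.
  split; [|rewrite E, E'; ring].
  Cmod_bound.
Qed.

(** The coefficients [b1], [b2] solve [g * (b0 + b1 h + b2 h^2) = 1 + O(h^3)];
    dividing by [g], which stays away from [0] near [z], keeps the error cubic. *)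
Lemma jet_inv g z a0 a1 a2 :
  jet g z a0 a1 a2 -> a0 <> RtoC 0 ->
  exists b1 b2, jet (fun w => / g w)%C z (/ a0)%C b1 b2.
Proof.
  intros (K & d & Hd & H) Ha.
  set (b1 := (- a1 / (a0 * a0))%C).
  set (b2 := ((a1 * a1 - a0 * a2) / (a0 * a0 * a0))%C).
  exists b1, b2.
  set (L := Cmod a1 + 1 * (Cmod a2 + 1 * K)).
  assert (Ha0 : 0 < Cmod a0) by now apply Cmod_gt_0.
  assert (HK : 0 <= K).
  { destruct (H (RtoC 0)) as (rho & Hr & _); [now rewrite Cmod_0|].
    eapply Rle_trans; [apply Cmod_ge_0|exact Hr]. }
  assert (HL : 0 <= L).
  { unfold L. pose proof (Cmod_ge_0 a1). pose proof (Cmod_ge_0 a2). lra. }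
  eexists _, (Rmin (Cmod a0 / 2 / (L + 1)) (Rmin 1 d)).
  split; [repeat apply Rmin_pos; try lra; repeat apply Rdiv_lt_0_compat; lra|].
  intros h Hh.
  assert (Hh0 : Cmod h < Cmod a0 / 2 / (L + 1)).
  { eapply Rlt_le_trans; [exact Hh|apply Rmin_l]. }
  assert (Hh' : Cmod h < Rmin 1 d).
  { eapply Rlt_le_trans; [exact Hh|apply Rmin_r]. }
  assert (Hh1 : Cmod h <= 1).
  { apply Rlt_le. eapply Rlt_le_trans; [exact Hh'|apply Rmin_l]. }
  destruct (H h) as (rho & Hr & E); [eapply Rlt_le_trans; [exact Hh'|apply Rmin_r]|].
  assert (HT : Cmod (a1 + h * (a2 + h * rho)) <= L) by (unfold L; Cmod_bound).
  assert (Hg : Cmod a0 / 2 <= Cmod (g (z + h)%C)).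
  { assert (Hs : Cmod a0 <= Cmod (g (z + h)%C) + Cmod h * Cmod (a1 + h * (a2 + h * rho))).
    { rewrite <- Cmod_mult, <- (Cmod_opp (h * _)).
      eapply Rle_trans; [|apply Cmod_triangle]. rewrite E. right. f_equal. ring. }
    assert (Hp : Cmod h * (L + 1) < Cmod a0 / 2) by (apply Rlt_div_r; [lra|exact Hh0]).
    pose proof (Cmod_ge_0 h). nra. }
  assert (Hgn : g (z + h)%C <> RtoC 0) by (apply Cmod_gt_0; lra).
  assert (Hgi : Cmod (/ g (z + h))%C <= / (Cmod a0 / 2)).
  { rewrite Cmod_inv by exact Hgn. apply Rinv_le_contravar; lra. }
  (* The error of the candidate expansion is h^3 T / g, see Hm. *)
  exists (- (1) * (/ g (z + h) * (a1 * b2 + (a2 * (b1 + h * b2) + rho * (/ a0 + h * (b1 + h * b2))))))%C.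
  split; [Cmod_bound|].
  assert (Hm : (g (z + h) * (/ a0 + h * (b1 + h * b2)) =
                1 + h * h * h * (a1 * b2 + (a2 * (b1 + h * b2) + rho * (/ a0 + h * (b1 + h * b2)))))%C).
  { rewrite E. unfold b1, b2. field. exact Ha. }
  set (T := (a1 * b2 + _)%C) in *.
  replace (/ a0 + h * (b1 + h * (b2 + h * (- (1) * (/ g (z + h) * T)))))%C
    with ((g (z + h) * (/ a0 + h * (b1 + h * b2)) - h * h * h * T) * / g (z + h))%C
    by (field; split; assumption).
  rewrite Hm. field. exact Hgn.
Qed.

(** The form of a jet used for limits: the quadratic part is absorbed in a bounded
    factor [T]. *)
Lemma jet_first_order g z a0 a1 a2 :
  jet g z a0 a1 a2 ->
  exists L d : R, 0 <= L /\ 0 < d <= 1 /\ forall h : C, Cmod h < d ->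
    exists T : C, Cmod T <= L /\ g (z + h)%C = (g z + h * (a1 + h * T))%C.
Proof.
  intros Hj. rewrite (jet_value _ _ _ _ _ Hj). destruct Hj as (K & d & Hd & H).
  exists (Cmod a2 + 1 * K), (Rmin 1 d). split; [|split].
  - destruct (H (RtoC 0)) as (rho & Hr & _); [now rewrite Cmod_0|].
    pose proof (Cmod_ge_0 a2). pose proof (Cmod_ge_0 rho). lra.
  - split; [apply Rmin_pos; lra|apply Rmin_l].
  - intros h Hh.
    assert (Hh1 : Cmod h <= 1).
    { apply Rlt_le. eapply Rlt_le_trans; [exact Hh|apply Rmin_l]. }
    destruct (H h) as (rho & Hr & E); [eapply Rlt_le_trans; [exact Hh|apply Rmin_r]|].
    exists (a2 + h * rho)%C. split; [Cmod_bound|exact E].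
Qed.

Lemma jet_continuous g z a0 a1 a2 :
  jet g z a0 a1 a2 -> forall eps, 0 < eps ->
  exists d, 0 < d /\ forall w, Cmod (w - z) < d -> Cmod (g w - g z) < eps.
Proof.
  intros Hj eps Heps.
  destruct (jet_first_order _ _ _ _ _ Hj) as (L & d & HL & Hd & H).
  set (B := Cmod a1 + 1 * L).
  assert (HB : 0 <= B) by (unfold B; pose proof (Cmod_ge_0 a1); lra).
  exists (Rmin (eps / (B + 1)) d).
  split; [apply Rmin_pos; [apply Rdiv_lt_0_compat|]; lra|].
  intros w Hw. set (h := (w - z)%C) in *.
  assert (Hh0 : Cmod h < eps / (B + 1)).
  { eapply Rlt_le_trans; [exact Hw|apply Rmin_l]. }
  assert (Hhd : Cmod h < d).
  { eapply Rlt_le_trans; [exact Hw|apply Rmin_r]. }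
  assert (Hh1 : Cmod h <= 1) by lra.
  destruct (H h Hhd) as (T & HT & E).
  replace w with (z + h)%C by (unfold h; ring). rewrite E.
  replace (g z + h * (a1 + h * T) - g z)%C with (h * (a1 + h * T))%C by ring.
  rewrite Cmod_mult.
  assert (HaT : Cmod (a1 + h * T) <= B) by (unfold B; Cmod_bound).
  assert (Hp : Cmod h * (B + 1) < eps) by (apply Rlt_div_r; [lra|exact Hh0]).
  pose proof (Cmod_ge_0 h). nra.
Qed.

(** [C_derive] is a limit of difference quotients along the real direction, and
    [h = x - fst z] runs through real increments. *)
Lemma jet_derive g z a0 a1 a2 : jet g z a0 a1 a2 -> C_derive g z = a1.
Proof.
  intros Hj.
  destruct (jet_first_order _ _ _ _ _ Hj) as (L & d & HL & Hd & H).
  assert (Hq : forall eps, 0 < eps -> exists e, 0 < e /\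
    forall x, Rabs (x - fst z) < e -> x <> fst z ->
      Cmod ((g (x, snd z) - g z) / ((x, snd z) - z) - a1)%C < eps).
  { intros eps Heps. exists (Rmin (eps / (L + 1)) d).
    split; [apply Rmin_pos; [apply Rdiv_lt_0_compat|]; lra|].
    intros x Hx Hne. set (h := RtoC (x - fst z)).
    assert (Eh : Cmod h = Rabs (x - fst z)) by apply Cmod_R.
    rewrite <- Eh in Hx.
    assert (Hh0 : Cmod h < eps / (L + 1)).
    { eapply Rlt_le_trans; [exact Hx|apply Rmin_l]. }
    destruct (H h) as (T & HT & E); [eapply Rlt_le_trans; [exact Hx|apply Rmin_r]|].
    assert (Ex : ((x, snd z) = z + h)%C).
    { unfold h, RtoC, Cplus. simpl. f_equal; ring. }
    assert (Hn : h <> RtoC 0).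
    { apply Cmod_gt_0. rewrite Eh. apply Rabs_pos_lt. lra. }
    rewrite Ex, E.
    replace ((g z + h * (a1 + h * T) - g z) / (z + h - z) - a1)%C with (h * T)%C.
    2:{ replace (z + h - z)%C with h by ring. field. exact Hn. }
    rewrite Cmod_mult.
    assert (Hp : Cmod h * (L + 1) < eps) by (apply Rlt_div_r; [lra|exact Hh0]).
    pose proof (Cmod_ge_0 h). nra. }
  unfold C_derive, C_lim.
  rewrite (surjective_pairing a1).
  f_equal; f_equal.
  - erewrite (is_lim_unique _ _ (Finite (fst a1))); [reflexivity|].
    apply is_lim_spec. intros eps.
    destruct (Hq eps (cond_pos eps)) as (e & He & Hx).
    exists (mkposreal e He). intros x Hb Hne.
    eapply Rle_lt_trans; [|apply (Hx x Hb Hne)].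
    eapply Rle_trans; [|apply re_le_Cmod].
    right; f_equal.
  - erewrite (is_lim_unique _ _ (Finite (snd a1))); [reflexivity|].
    apply is_lim_spec. intros eps.
    destruct (Hq eps (cond_pos eps)) as (e & He & Hx).
    exists (mkposreal e He). intros x Hb Hne.
    eapply Rle_lt_trans; [|apply (Hx x Hb Hne)].
    eapply Rle_trans; [|eapply Rle_trans; [apply Rmax_r|apply Rmax_Cmod]].
    right; f_equal.
Qed.

Lemma Cps_jet (r : R) (a : nat -> C) (f : C -> C) (z : C) :
  0 < r -> (forall h, Cmod h < r -> Cps a h (f (z + h)%C)) ->
  jet f z (a 0%nat) (a 1%nat) (a 2%nat).
Proof.
  intros Hr Hf.
  set (s := r / 2).
  assert (Ha : Cps_on r a) by (intros h Hh; exists (f (z + h)%C); now apply Hf).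
  assert (Hs : ex_series (fun n => Cmod (a (S (S (S n)))) * s ^ n)).
  { pose proof (Cps_on_abs r a s Ha ltac:(unfold s; lra)) as H.
    do 3 apply ex_series_incr_1 in H.
    apply (ex_series_scal_l (K := R_AbsRing) (V := R_NormedModule) (/ s ^ 3)) in H.
    eapply ex_series_ext; [|exact H]. intros n.
    change (/ s ^ 3 * (Cmod (a (S (S (S n)))) * s ^ S (S (S n))) = Cmod (a (S (S (S n)))) * s ^ n).
    simpl. field. unfold s; lra. }
  destruct Hs as [K HK].
  exists K, s. split; [unfold s; lra|].
  intros h Hh.
  assert (Hle : forall n, Cmod (a (S (S (S n))) * h ^ n)%C <= Cmod (a (S (S (S n)))) * s ^ n).
  { intros n. rewrite Cmod_mult, Cmod_pow. apply Rmult_le_compat_l; [apply Cmod_ge_0|].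
    apply pow_incr. split; [apply Cmod_ge_0|lra]. }
  destruct (Cseries_of_abs _ _ Hle) as [rho Hrho]; [now exists K|].
  exists rho. split; [exact (Cseries_Cmod_le _ _ _ _ Hrho HK Hle)|].
  eapply Cseries_unique; [apply Hf; unfold s in Hh; lra|].
  exact (Cps_S a h _ (Cps_S (fun n => a (S n)) h _ (Cps_S (fun n => a (S (S n))) h _ Hrho))).
Qed.

Definition Cps_deriv (a : nat -> C) (n : nat) : C := (RtoC (INR (S n)) * a (S n))%C.

(** Recentring at [z0 + h] turns the derivative there into the linear coefficient
    of the new expansion, which is the termwise derivative of the old one. *)
Lemma Cps_C_derive (r : R) (a : nat -> C) (f : C -> C) (z0 : C) :
  (forall h, Cmod h < r -> Cps a h (f (z0 + h)%C)) ->
  forall h, Cmod h < r -> Cps (Cps_deriv a) h (C_derive f (z0 + h)%C).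
Proof.
  intros Hf h Hh.
  destruct (Cps_recentre r a h) as (b & Hb & Hs);
    [intros k Hk; eexists; now apply Hf|exact Hh|].
  assert (Hj : jet f (z0 + h)%C (b 0%nat) (b 1%nat) (b 2%nat)).
  { apply (Cps_jet (r - Cmod h)); [lra|].
    intros k Hk. apply Hs; [exact Hk|]. rewrite <- Cplus_assoc. apply Hf.
    eapply Rle_lt_trans; [apply Cmod_triangle|]. lra. }
  rewrite (jet_derive _ _ _ _ _ Hj).
  specialize (Hb 1%nat).
  apply (Cseries_ext (fun n => a (S n) * tcoef h (S n) 1)%C).
  { intros n. rewrite tcoef_1. unfold Cps_deriv. ring. }
  apply (is_series_incr_1 (V := C_NormedModule) (fun n => a n * tcoef h n 1)%C).
  match goal with |- is_series _ ?x => replace x with (b 1%nat) end; [exact Hb|].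
  change (b 1%nat = b 1%nat + a 0%nat * 0)%C. ring.
Qed.

Lemma analytic_Cps (f : C -> C) (z0 : C) :
  analytic_on_disc f -> Defs.disc z0 ->
  exists (r : R) (a : nat -> C), 0 < r /\ forall h : C, Cmod h < r -> Cps a h (f (z0 + h)%C).
Proof.
  intros Hf Hz. destruct (Hf z0 Hz) as (r & a & H).
  exists r, a. split; [apply cond_pos|]. intros h Hh. apply Cps_is_pseries.
  specialize (H (z0 + h)%C). replace (z0 + h - z0)%C with h in H by ring. now apply H.
Qed.

(** The expansion around [z0] differentiates termwise in its whole disc of
    convergence. *)
Lemma analytic_C_derive (f : C -> C) :
  analytic_on_disc f -> analytic_on_disc (C_derive f).
Proof.
  intros Hf z0 Hz. destruct (analytic_Cps f z0 Hf Hz) as (r & a & Hr & H).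
  exists (mkposreal r Hr), (Cps_deriv a). intros z Hzr. apply (proj1 (Cps_is_pseries _ _ _)).
  pose proof (Cps_C_derive r a f z0 H (z - z0)%C Hzr) as H'.
  replace (z0 + (z - z0))%C with z in H' by ring. exact H'.
Qed.

Lemma Cps_analytic (a : nat -> C) (f : C -> C) :
  (forall z, Cmod z < 1 -> Cps a z (f z)) -> analytic_on_disc f.
Proof.
  intros H z Hz.
  destruct (Cps_recentre 1 a z) as (b & _ & Hb); [intros w Hw; eexists; now apply H|exact Hz|].
  assert (Hr : 0 < 1 - Cmod z) by (unfold Defs.disc in Hz; lra).
  exists (mkposreal _ Hr), b. intros w Hw. apply (proj1 (Cps_is_pseries _ _ _)).
  simpl in Hw. apply Hb; [exact Hw|].
  replace (z + (w - z))%C with w by ring. apply H.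
  replace w with (z + (w - z))%C by ring.
  eapply Rle_lt_trans; [apply Cmod_triangle|]. lra.
Qed.

Lemma Cps_C_derive_0 (a : nat -> C) (f : C -> C) :
  (forall z, Cmod z < 1 -> Cps a z (f z)) ->
  forall z, Cmod z < 1 -> Cps (Cps_deriv a) z (C_derive f z).
Proof.
  intros H z Hz. rewrite <- (Cplus_0_l z) at 2.
  apply (Cps_C_derive 1 a); [|exact Hz].
  intros h Hh. rewrite Cplus_0_l. now apply H.
Qed.

Definition has_jet (g : C -> C) (z : C) : Prop := exists a0 a1 a2, jet g z a0 a1 a2.

Lemma has_jet_mult g k z : has_jet g z -> has_jet k z -> has_jet (fun w => g w * k w)%C z.
Proof.
  intros (a0 & a1 & a2 & H) (b0 & b1 & b2 & H'). do 3 eexists. exact (jet_mult _ _ _ _ _ _ _ _ _ H H').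
Qed.

Lemma has_jet_plus g k z : has_jet g z -> has_jet k z -> has_jet (fun w => g w + k w)%C z.
Proof.
  intros (a0 & a1 & a2 & H) (b0 & b1 & b2 & H'). do 3 eexists. exact (jet_plus _ _ _ _ _ _ _ _ _ H H').
Qed.

Lemma has_jet_inv g z : has_jet g z -> g z <> RtoC 0 -> has_jet (fun w => / g w)%C z.
Proof.
  intros (a0 & a1 & a2 & H) Hg. rewrite (jet_value _ _ _ _ _ H) in Hg.
  destruct (jet_inv _ _ _ _ _ H Hg) as (b1 & b2 & Hb). now exists (/ a0)%C, b1, b2.
Qed.

Lemma has_jet_const c z : has_jet (fun _ => c) z.
Proof. do 3 eexists. apply jet_const. Qed.

Lemma has_jet_id z : has_jet (fun w => w) z.
Proof. do 3 eexists. apply jet_id. Qed.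

Lemma has_jet_ext g k z e :
  0 < e -> (forall h, Cmod h < e -> g (z + h)%C = k (z + h)%C) ->
  has_jet g z -> has_jet k z.
Proof.
  intros He Hgk (a0 & a1 & a2 & H). exists a0, a1, a2. exact (jet_ext _ _ _ _ _ _ e He Hgk H).
Qed.

Lemma analytic_has_jet (f : C -> C) (z : C) :
  analytic_on_disc f -> Defs.disc z -> has_jet f z.
Proof.
  intros Hf Hz. destruct (analytic_Cps f z Hf Hz) as (r & a & Hr & H).
  exists (a 0%nat), (a 1%nat), (a 2%nat). exact (Cps_jet r a f z Hr H).
Qed.

Lemma analytic_jet_derive f w :
  analytic_on_disc f -> Defs.disc w -> exists a2, jet f w (f w) (C_derive f w) a2.
Proof.
  intros Hf Hw. destruct (analytic_has_jet f w Hf Hw) as (a0 & a1 & a2 & H).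
  exists a2. now rewrite (jet_derive _ _ _ _ _ H), (jet_value _ _ _ _ _ H).
Qed.

(** * The maximum modulus principle *)

Lemma Cmod_le_Re_Im (z : C) : Cmod z <= Rabs (Re z) + Rabs (Im z).
Proof.
  replace z with (RtoC (Re z) + Ci * RtoC (Im z))%C at 1.
  - eapply Rle_trans; [apply Cmod_triangle|].
    rewrite Cmod_mult, Cmod_Ci, !Cmod_R. lra.
  - destruct z as [x y]. unfold RtoC, Ci, Cplus, Cmult. simpl. f_equal; ring.
Qed.

(** Given a radius [delta u v] around each centre [(u, v)], compactness provides one
    [d > 0] such that each point has a nearby centre with [d <= delta u v].  Choosing [delta] both
    as radius and so that the local bound is at most [/ delta u v], the number [/ d]
    bounds [G] globally.  Centres outside the closed disc get a [delta] too small to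
    reach it. *)
Lemma locally_bounded_on_disc (rho : R) (G : C -> R) :
  (forall z, Cmod z <= rho -> exists d B, 0 < d /\
     forall w, Cmod w <= rho -> Cmod (w - z) < d -> G w <= B) ->
  exists B, forall w, Cmod w <= rho -> G w <= B.
Proof.
  intros Hloc.
  assert (Hdel : forall u v : R, exists d : posreal, forall w, Cmod w <= rho ->
            Cmod (w - (u, v)) < 2 * d -> G w <= / d).
  { intros u v. destruct (Rle_dec (Cmod (u, v)) rho) as [Hin|Hout].
    - destruct (Hloc _ Hin) as (d & B & Hd & HB).
      assert (H1 : 0 < / (Rabs B + 1)).
      { apply Rinv_0_lt_compat. pose proof (Rabs_pos B). lra. }
      assert (Hp : 0 < Rmin (d / 2) (/ (Rabs B + 1))) by (apply Rmin_pos; lra).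
      exists (mkposreal _ Hp). intros w Hw Hdist. simpl in *.
      apply Rle_trans with (/ / (Rabs B + 1)).
      + rewrite Rinv_inv. apply Rle_trans with B.
        * apply HB; [exact Hw|]. eapply Rlt_le_trans; [exact Hdist|].
          pose proof (Rmin_l (d / 2) (/ (Rabs B + 1))). lra.
        * pose proof (Rle_abs B). lra.
      + apply Rinv_le_contravar; [exact Hp|apply Rmin_r].
    - assert (Hp : 0 < (Cmod (u, v) - rho) / 2) by lra.
      exists (mkposreal _ Hp). intros w Hw Hdist. exfalso. simpl in Hdist.
      pose proof (Cmod_triangle w (- (w - (u, v)))) as Ht.
      rewrite Cmod_opp in Ht. replace (w + - (w - (u, v)))%C with (@pair R R u v) in Ht
        by (destruct w; unfold Cminus, Cplus, Copp; simpl; f_equal; ring).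
      lra. }
  set (delta := fun u v => proj1_sig (constructive_indefinite_description _ (Hdel u v))).
  assert (Hdelta : forall u v w, Cmod w <= rho -> Cmod (w - (u, v)) < 2 * delta u v ->
            G w <= / delta u v).
  { intros u v. exact (proj2_sig (constructive_indefinite_description _ (Hdel u v))). }
  destruct (compactness_value_2d (- rho) rho (- rho) rho delta) as [d Hd].
  exists (/ d). intros w Hw.
  assert (Hre : Rabs (Re w) <= rho) by (eapply Rle_trans; [apply re_le_Cmod|exact Hw]).
  assert (Him : Rabs (Im w) <= rho).
  { eapply Rle_trans; [|exact Hw]. eapply Rle_trans; [apply Rmax_r|apply Rmax_Cmod]. }
  apply Rabs_le_between in Hre. apply Rabs_le_between in Him.
  apply NNPP. intros Hcontra. apply (Hd (Re w) (Im w) Hre Him).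
  intros (u & v & _ & _ & Hu & Hv & Hle). apply Hcontra.
  apply Rle_trans with (/ delta u v).
  - apply Hdelta; [exact Hw|]. eapply Rle_lt_trans; [apply Cmod_le_Re_Im|].
    change (Rabs (Re w - u) + Rabs (Im w - v) < 2 * delta u v). lra.
  - apply Rinv_le_contravar; [apply cond_pos|exact Hle].
Qed.

(** If the supremum [M] were not attained, [/ (M - G)] would be locally bounded,
    hence bounded, and [G] would stay away from [M]. *)
Lemma continuous_max_on_disc (rho : R) (G : C -> R) :
  0 <= rho ->
  (forall z, Cmod z <= rho -> forall eps, 0 < eps -> exists d, 0 < d /\
     forall w, Cmod w <= rho -> Cmod (w - z) < d -> Rabs (G w - G z) < eps) ->
  exists z, Cmod z <= rho /\ forall w, Cmod w <= rho -> G w <= G z.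
Proof.
  intros Hrho Hc.
  set (E := fun x => exists z, Cmod z <= rho /\ x = G z).
  destruct (completeness E) as [M [HM1 HM2]].
  - destruct (locally_bounded_on_disc rho G) as [B HB].
    + intros z Hz. destruct (Hc z Hz 1 Rlt_0_1) as (d & Hd & H).
      exists d, (G z + 1). split; [exact Hd|]. intros w Hw Hwz.
      specialize (H w Hw Hwz). apply Rabs_def2 in H. lra.
    + exists B. intros x (z & Hz & ->). now apply HB.
  - exists (G (RtoC 0)), (RtoC 0). rewrite Cmod_0. now split.
  - apply NNPP. intros Hno.
    assert (Hlt : forall z, Cmod z <= rho -> G z < M).
    { intros z Hz. destruct (Rle_lt_or_eq_dec (G z) M) as [H|H]; [|exact H|].
      - apply HM1. now exists z.
      - exfalso. apply Hno. exists z. split; [exact Hz|].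
        intros w Hw. rewrite H. apply HM1. now exists w. }
    destruct (locally_bounded_on_disc rho (fun z => / (M - G z))) as [B HB].
    + intros z Hz. pose proof (Hlt z Hz) as Hz'.
      destruct (Hc z Hz ((M - G z) / 2)) as (d & Hd & H); [lra|].
      exists d, (/ ((M - G z) / 2)). split; [exact Hd|]. intros w Hw Hwz.
      specialize (H w Hw Hwz). apply Rabs_def2 in H.
      apply Rinv_le_contravar; lra.
    + assert (HB0 : 0 < B).
      { eapply Rlt_le_trans; [|apply (HB (RtoC 0)); now rewrite Cmod_0].
        apply Rinv_0_lt_compat. specialize (Hlt (RtoC 0)). rewrite Cmod_0 in Hlt. lra. }
      assert (Hup : is_upper_bound E (M - / B)).
      { intros x (z & Hz & ->). specialize (HB z Hz). specialize (Hlt z Hz).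
        apply Rinv_le_contravar in HB; [|apply Rinv_0_lt_compat; lra].
        rewrite Rinv_inv in HB. lra. }
      apply HM2 in Hup. pose proof (Rinv_0_lt_compat B HB0). lra.
Qed.

(** The parallelogram law, applied twice. *)
Lemma Cmod2_shift (z : C) (t : R) :
  Cmod (z + RtoC t) ^ 2 + Cmod (z + - RtoC t) ^ 2 +
  (Cmod (z + Ci * RtoC t) ^ 2 + Cmod (z + - (Ci * RtoC t)) ^ 2) =
  4 * Cmod z ^ 2 + 4 * t ^ 2.
Proof.
  rewrite !Cmod2_alt. destruct z as [x y]. simpl. ring.
Qed.

(** The term [eps |z|^2] makes the function strictly subharmonic, which forbids
    an interior maximum; then [eps] is sent to [0]. *)
Lemma max_principle_Re (rho M : R) (g : C -> C) :
  0 <= rho ->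
  (forall z, Cmod z <= rho -> has_jet g z) ->
  (forall z, Cmod z = rho -> Re (g z) <= M) ->
  forall z, Cmod z <= rho -> Re (g z) <= M.
Proof.
  intros Hrho Hj Hbd.
  assert (Heps : forall eps, 0 < eps -> forall z, Cmod z <= rho ->
            Re (g z) + eps * Cmod z ^ 2 <= M + eps * rho ^ 2).
  { intros eps Heps.
    set (G := fun z => Re (g z) + eps * Cmod z ^ 2).
    destruct (continuous_max_on_disc rho G Hrho) as (z0 & Hz0 & Hmax).
    { intros z Hz e He.
      destruct (Hj z Hz) as (a0 & a1 & a2 & Ja).
      destruct (jet_continuous _ _ _ _ _ Ja (e / 2)) as (d & Hd & Hgd); [lra|].
  set (L := 2 * rho * eps + 1).
      assert (HL : 0 < L) by (unfold L; nra).
      exists (Rmin d (e / 2 / L)). split; [apply Rmin_pos; [lra|apply Rdiv_lt_0_compat; lra]|].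
      intros w Hw Hwz.
      assert (H1 : Rabs (Re (g w) - Re (g z)) < e / 2).
      { eapply Rle_lt_trans; [apply (re_le_Cmod (g w - g z))|].
        apply Hgd. eapply Rlt_le_trans; [exact Hwz|apply Rmin_l]. }
      assert (H2 : Cmod (w - z) * L < e / 2).
      { apply Rlt_div_r; [exact HL|]. eapply Rlt_le_trans; [exact Hwz|apply Rmin_r]. }
      assert (H3 : Rabs (Cmod w - Cmod z) <= Cmod (w - z)).
      { apply Rabs_le. pose proof (Cmod_triangle (w - z) z) as T1.
        pose proof (Cmod_triangle w (- (w - z))) as T2. rewrite Cmod_opp in T2.
        replace (w - z + z)%C with w in T1 by ring.
        replace (w + - (w - z))%C with z in T2 by ring. lra. }
      unfold G.
      replace (Re (g w) + eps * Cmod w ^ 2 - (Re (g z) + eps * Cmod z ^ 2))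
        with ((Re (g w) - Re (g z)) + (Cmod w - Cmod z) * ((Cmod w + Cmod z) * eps)) by ring.
      eapply Rle_lt_trans; [apply Rabs_triang|]. rewrite Rabs_mult.
      pose proof (Cmod_ge_0 w). pose proof (Cmod_ge_0 z). pose proof (Cmod_ge_0 (w - z)).
      rewrite (Rabs_pos_eq ((Cmod w + Cmod z) * eps)) by (apply Rmult_le_pos; lra).
      assert ((Cmod w + Cmod z) * eps <= L) by (unfold L; nra).
      assert (Rabs (Cmod w - Cmod z) * ((Cmod w + Cmod z) * eps) <= Cmod (w - z) * L).
      { apply Rmult_le_compat; try lra; [apply Rabs_pos|apply Rmult_le_pos; lra]. }
      lra. }
    intros z Hz. eapply Rle_trans; [apply (Hmax z Hz)|]. unfold G.
    destruct (Rle_lt_or_eq_dec _ _ Hz0) as [Hlt|Heq].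
    2:{ rewrite Heq. specialize (Hbd z0 Heq). lra. }
    exfalso.
    destruct (Hj z0 Hz0) as (a0 & a1 & a2 & Ja).
    pose proof (jet_value _ _ _ _ _ Ja) as Hv.
    destruct Ja as (K & d & Hd & HK).
    assert (HK0 : 0 <= K).
    { destruct (HK (RtoC 0)) as (r & Hr & _); [now rewrite Cmod_0|].
      eapply Rle_trans; [apply Cmod_ge_0|exact Hr]. }
    (* Small enough to stay in the disc and to let the gain 4 eps t^2 beat the
       four cubic errors, at most K t^3 each. *)
    set (t := Rmin (Rmin (d / 2) ((rho - Cmod z0) / 2)) (eps / (2 * (K + 1)))).
    assert (Ht : 0 < t).
    { unfold t. repeat apply Rmin_pos; try lra. apply Rdiv_lt_0_compat; lra. }
    assert (Ht1 : t < d).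
    { apply Rle_lt_trans with (d / 2); [|lra].
      unfold t. eapply Rle_trans; [apply Rmin_l|apply Rmin_l]. }
    assert (Ht2 : t <= rho - Cmod z0).
    { apply Rle_trans with ((rho - Cmod z0) / 2); [|lra].
      unfold t. eapply Rle_trans; [apply Rmin_l|apply Rmin_r]. }
    assert (Ht3 : t * (2 * (K + 1)) <= eps).
    { apply Rle_div_r; [lra|]. unfold t. apply Rmin_r. }
    assert (Hpt : forall h, Cmod h = t -> exists r, Cmod r <= K /\
       Re (a0 + h * a1 + h * h * a2 + h * h * h * r) + eps * Cmod (z0 + h) ^ 2 <=
       Re a0 + eps * Cmod z0 ^ 2).
    { intros h Hh. destruct (HK h) as (r & Hr & E); [lra|].
      exists r. split; [exact Hr|].
      assert (Hin : Cmod (z0 + h) <= rho).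
      { eapply Rle_trans; [apply Cmod_triangle|]. lra. }
      specialize (Hmax _ Hin). unfold G in Hmax. rewrite E, Hv in Hmax.
      replace (a0 + h * a1 + h * h * a2 + h * h * h * r)%C
        with (a0 + h * (a1 + h * (a2 + h * r)))%C by ring. exact Hmax. }
    assert (Hrt : Cmod (RtoC t) = t) by (rewrite Cmod_R; apply Rabs_pos_eq; lra).
    destruct (Hpt (RtoC t)) as (r1 & Hr1 & B1); [exact Hrt|].
    destruct (Hpt (- RtoC t)%C) as (r2 & Hr2 & B2); [now rewrite Cmod_opp|].
    destruct (Hpt (Ci * RtoC t)%C) as (r3 & Hr3 & B3).
    { rewrite Cmod_mult, Cmod_Ci, Hrt. ring. }
    destruct (Hpt (- (Ci * RtoC t))%C) as (r4 & Hr4 & B4).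
    { rewrite Cmod_opp, Cmod_mult, Cmod_Ci, Hrt. ring. }
    pose proof (Cmod2_shift z0 t) as Hsh.
    assert (Hre : forall r : C, Cmod r <= K -> Rabs (Re r) <= K /\ Rabs (Im r) <= K).
    { intros r Hr. split; (eapply Rle_trans; [|exact Hr]); [apply re_le_Cmod|].
      eapply Rle_trans; [apply Rmax_r|apply Rmax_Cmod]. }
    destruct (Hre r1 Hr1) as [Q1 _]. destruct (Hre r2 Hr2) as [Q2 _].
    destruct (Hre r3 Hr3) as [_ Q3]. destruct (Hre r4 Hr4) as [_ Q4].
    apply Rabs_le_between in Q1. apply Rabs_le_between in Q2.
    apply Rabs_le_between in Q3. apply Rabs_le_between in Q4.
    set (s1 := Cmod (z0 + RtoC t) ^ 2) in *. set (s2 := Cmod (z0 + - RtoC t) ^ 2) in *.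
    set (s3 := Cmod (z0 + Ci * RtoC t) ^ 2) in *. set (s4 := Cmod (z0 + - (Ci * RtoC t)) ^ 2) in *.
    (* Sum of B1 to B4: the coefficients a1 and a2 cancel, as the four shifts and
       their squares sum to 0. *)
    assert (Hsum : t ^ 3 * (Re r1 - Re r2 + Im r3 - Im r4) + eps * (4 * t ^ 2) <= 0).
    { rewrite !re_plus, !re_mult, !im_mult in *.
      simpl in B1, B2, B3, B4. nra. }
    assert (Hcube : - (4 * K) <= Re r1 - Re r2 + Im r3 - Im r4) by lra.
    assert (t ^ 2 * (4 * eps - t * (4 * K)) <= 0).
    { assert (0 <= t ^ 3) by (apply pow_le; lra). nra. }
    assert (0 < t ^ 2) by now apply pow_lt.
    nra. }
  intros z Hz.
  apply Rnot_lt_le. intros Hlt.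
  set (e := (Re (g z) - M) / (2 * (rho ^ 2 + 1))).
  assert (Hr2 : 0 <= rho ^ 2) by (apply pow_le; lra).
  assert (He : 0 < e) by (unfold e; apply Rdiv_lt_0_compat; lra).
  specialize (Heps e He z Hz).
  assert (e * (rho ^ 2 + 1) = (Re (g z) - M) / 2) by (unfold e; field; lra).
  assert (0 <= e * Cmod z ^ 2) by (apply Rmult_le_pos; [lra|apply pow_le, Cmod_ge_0]).
  nra.
Qed.

(** Rotating [g] by the conjugate of its value at [z] reduces the modulus at [z] to
    a real part. *)
Lemma max_modulus (rho M : R) (g : C -> C) :
  0 <= rho ->
  (forall z, Cmod z <= rho -> has_jet g z) ->
  (forall z, Cmod z = rho -> Cmod (g z) <= M) ->
  forall z, Cmod z <= rho -> Cmod (g z) <= M.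
Proof.
  intros Hrho Hj Hbd z Hz.
  assert (H : Re (Cconj (g z) * g z) <= Cmod (g z) * M).
  { apply (max_principle_Re rho (Cmod (g z) * M) (fun w => Cconj (g z) * g w)%C Hrho); [| |exact Hz].
    - intros w Hw. apply has_jet_mult; [apply has_jet_const|now apply Hj].
    - intros w Hw. eapply Rle_trans; [apply Rle_abs|]. eapply Rle_trans; [apply re_le_Cmod|].
      rewrite Cmod_mult, Cmod_conj. apply Rmult_le_compat_l; [apply Cmod_ge_0|now apply Hbd]. }
  rewrite Cmult_comm, <- Cmod2_conj, re_RtoC in H.
  destruct (Rle_lt_or_eq_dec 0 (Cmod (g z)) (Cmod_ge_0 _)) as [Hp|H0].
  - nra.
  - rewrite <- H0.
    assert (Ex : Cmod (RtoC rho) = rho) by (rewrite Cmod_R; now apply Rabs_pos_eq).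
    eapply Rle_trans; [apply Cmod_ge_0|exact (Hbd _ Ex)].
Qed.

(** * The bound for the pre-Schwarzian norm *)

(** [g (z) / z] for [g] vanishing at [0], with its limit as value at [0]. *)
Definition removable_quotient (g : C -> C) (z : C) : C :=
  if excluded_middle_informative (z = RtoC 0) then C_derive g (RtoC 0) else (g z / z)%C.

Lemma removable_quotient_mult g z :
  g (RtoC 0) = RtoC 0 -> (z * removable_quotient g z)%C = g z.
Proof.
  intros H0. unfold removable_quotient. destruct (excluded_middle_informative _) as [->|Hz].
  - rewrite H0. ring.
  - field. exact Hz.
Qed.

(** At [0] the quotient is the sum of the shifted power series of [g]; elsewhere it is
    a quotient of functions with jets. *)
Lemma removable_quotient_jet g z :
  analytic_on_disc g -> g (RtoC 0) = RtoC 0 -> Defs.disc z -> has_jet (removable_quotient g) z.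
Proof.
  intros Hg H0 Hz.
  destruct (excluded_middle_informative (z = RtoC 0)) as [->|Hn].
  - destruct (analytic_Cps g (RtoC 0) Hg Hz) as (r & a & Hr & Ha).
    pose proof (Cps_jet r a g _ Hr Ha) as Hj.
    pose proof (jet_value _ _ _ _ _ Hj) as Ha0. rewrite H0 in Ha0.
    exists (a 1%nat), (a 2%nat), (a 3%nat).
    apply (Cps_jet r (fun n => a (S n))); [exact Hr|]. intros h Hh.
    unfold removable_quotient. rewrite Cplus_0_l.
    destruct (excluded_middle_informative (h = RtoC 0)) as [->|Hh0].
    + rewrite (jet_derive _ _ _ _ _ Hj).
      apply (Cps_at_0 (fun n => a (S n))).
    + specialize (Ha h Hh). rewrite Cplus_0_l in Ha.
      apply (Cseries_ext (fun n => / h * (a (S n) * h ^ S n))%C).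
      { intros n. rewrite Cpow_S. field. exact Hh0. }
      replace (g h / h)%C with (/ h * g h)%C by (field; exact Hh0).
      apply Cseries_scal.
      apply (is_series_incr_1 (V := C_NormedModule) (fun n => a n * h ^ n)%C).
      match goal with |- is_series _ ?x => replace x with (g h) end; [exact Ha|].
      rewrite <- Ha0. change (g h = g h + 0 * 1)%C. ring.
  - apply (has_jet_ext (fun w => g w * / w)%C _ _ (Cmod z)).
    + now apply Cmod_gt_0.
    + intros h Hh. unfold removable_quotient.
      destruct (excluded_middle_informative _) as [E|_]; [|reflexivity].
      exfalso. replace h with (- z)%C in Hh.
      * rewrite Cmod_opp in Hh. lra.
      * replace h with (z + h - z)%C by ring. rewrite E. ring.
    + apply has_jet_mult; [now apply analytic_has_jet|].
      apply has_jet_inv; [apply has_jet_id|exact Hn].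
Qed.

Lemma Cmod_cexpi alpha : Cmod (cexpi alpha) = 1.
Proof.
  unfold cexpi, Cmod. simpl fst. simpl snd.
  replace (cos alpha ^ 2 + sin alpha ^ 2) with 1; [apply sqrt_1|].
  pose proof (sin2_cos2 alpha) as H. unfold Rsqr in H. simpl. lra.
Qed.

(** The line [Re = - c] is the perpendicular bisector of [0] and [- 2 c]. *)
Lemma half_plane_Cmod (v : C) (c : R) :
  0 < c -> - c < Re v -> Cmod v < Cmod (v + RtoC (2 * c)).
Proof.
  intros Hc Hv. apply Rsqr_incrst_0; try apply Cmod_ge_0.
  rewrite !Rsqr_pow2, !Cmod2_alt. destruct v as [x y]. simpl in *. nra.
Qed.

(** The passage to the limit [rho -> 1]. *)
Lemma le_1_of_sqr_bound (x r : R) :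
  0 <= r < 1 -> (forall rho, r <= rho < 1 -> 0 < rho -> x <= 1 / rho ^ 2) -> x <= 1.
Proof.
  intros Hr H. apply Rnot_lt_le. intros Hx.
  (* Arithmetic-geometric mean: the square of (1 + y) / 2 exceeds y = 1 / x. *)
  set (y := / x).
  assert (Hxy : x * y = 1) by (unfold y; field; lra).
  assert (Hy : 0 < y < 1).
  { split; [unfold y; apply Rinv_0_lt_compat; lra|nra]. }
  set (rho := Rmax r ((1 + y) / 2)).
  assert (H1 : (1 + y) / 2 <= rho) by apply Rmax_r.
  assert (H2 : rho < 1) by (unfold rho; apply Rmax_lub_lt; lra).
  specialize (H rho (conj (Rmax_l _ _) H2) ltac:(lra)).
  apply Rle_div_r in H; [|apply pow_lt; lra].
  assert (((1 + y) / 2) ^ 2 <= rho ^ 2) by (apply pow_incr; lra).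
  assert (y < ((1 + y) / 2) ^ 2) by (simpl; nra).
  nra.
Qed.

Lemma cos_alpha_pos alpha : - PI / 2 < alpha < PI / 2 -> 0 < cos alpha.
Proof. intros H. apply cos_gt_0; lra. Qed.

(** The Schwarz argument of order two: the maximum principle is applied to [W], on
    circles whose radius tends to [1]. *)
Lemma SP0_pre_Schwarzian_bound (alpha beta : R) (f : C -> C) (z : C) :
  - PI / 2 < alpha < PI / 2 -> 0 <= beta < 1 -> SP0 alpha beta f -> Defs.disc z ->
  (1 - Cmod z ^ 2) * Cmod (pre_Schwarzian f z) <= 2 * (1 - beta) * cos alpha.
Proof.
  intros Halpha Hbeta [[[Hf _] [Hne HRe]] H20] Hz.
  set (c := (1 - beta) * cos alpha).
  assert (Hc : 0 < c).
  { pose proof (cos_alpha_pos alpha Halpha). apply Rmult_lt_0_compat; lra. }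
  set (e := cexpi alpha) in *.
  assert (He : Cmod e = 1) by apply Cmod_cexpi.
  pose proof (analytic_C_derive f Hf) as Hf1.
  pose proof (analytic_C_derive _ Hf1) as Hf2.
  set (f1 := C_derive f) in *. set (f2 := C_derive f1) in *.
  set (q := removable_quotient f2).
  assert (Hq : forall w, (w * q w)%C = f2 w) by (intros w; now apply removable_quotient_mult).
  set (D := fun w => (w * w * (q w * e) + RtoC (2 * c) * f1 w)%C).
  assert (HD : forall w, Defs.disc w -> Cmod (w * w * (q w * e)) < Cmod (D w)).
  { intros w Hw. specialize (Hne w Hw). specialize (HRe w Hw).
    set (v := (e * (w * f2 w / f1 w))%C).
    assert (E : (w * w * (q w * e) = f1 w * v)%C).
    { unfold v. rewrite <- Hq. field. exact Hne. }
    unfold D. rewrite E.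
    replace (f1 w * v + RtoC (2 * c) * f1 w)%C with (f1 w * (v + RtoC (2 * c)))%C by ring.
    rewrite !Cmod_mult. apply Rmult_lt_compat_l; [now apply Cmod_gt_0|].
    apply half_plane_Cmod; [exact Hc|].
    replace (e * (1 + w * f2 w / f1 w))%C with (e + v)%C in HRe by (unfold v; ring).
    rewrite re_plus in HRe. change (Re e) with (cos alpha) in HRe. unfold c. lra. }
  set (W := fun w => (q w * e * / D w)%C).
  assert (HDn : forall w, Defs.disc w -> D w <> RtoC 0).
  { intros w Hw. apply Cmod_gt_0. eapply Rle_lt_trans; [apply Cmod_ge_0|now apply HD]. }
  assert (HJ : forall w, Defs.disc w -> has_jet W w).
  { intros w Hw.
    assert (Hqj : has_jet (fun w => q w * e)%C w).
    { apply has_jet_mult; [|apply has_jet_const]. now apply removable_quotient_jet. }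
    apply has_jet_mult; [exact Hqj|]. apply has_jet_inv; [|now apply HDn].
    apply has_jet_plus; apply has_jet_mult; try exact Hqj; try apply has_jet_const.
    - apply has_jet_mult; apply has_jet_id.
    - now apply analytic_has_jet. }
  assert (HW : Cmod (W z) <= 1).
  { apply (le_1_of_sqr_bound _ (Cmod z)); [split; [apply Cmod_ge_0|exact Hz]|].
    intros rho [Hr1 Hr2] Hr0.
    apply (max_modulus rho _ W); [lra| | |exact Hr1].
    - intros w Hw. apply HJ. unfold Defs.disc. lra.
    - intros w Hw. assert (Hwd : Defs.disc w) by (unfold Defs.disc; lra).
      apply Rle_div_r; [now apply pow_lt|].
      rewrite <- Hw, <- Cmod_pow, <- Cmod_mult.
      specialize (HD w Hwd). specialize (HDn w Hwd).
      replace (W w * w ^ 2)%C with (w * w * (q w * e) / D w)%C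
        by (unfold W; simpl; field; exact HDn).
      rewrite Cmod_div by exact HDn.
      apply Rle_div_l; [now apply Cmod_gt_0|lra]. }
  assert (Hqz : Cmod (q z) <= Cmod (D z)).
  { replace (Cmod (q z)) with (Cmod (W z) * Cmod (D z)).
    - pose proof (Cmod_ge_0 (D z)). nra.
    - rewrite <- Cmod_mult. unfold W.
      replace (q z * e * / D z * D z)%C with (q z * e)%C by (field; now apply HDn).
      rewrite Cmod_mult, He. ring. }
  assert (HDz : Cmod (D z) <= Cmod z ^ 2 * Cmod (q z) + 2 * c * Cmod (f1 z)).
  { unfold D. eapply Rle_trans; [apply Cmod_triangle|].
    rewrite !Cmod_mult, He, Cmod_R, Rabs_pos_eq by lra. simpl. lra. }
  unfold pre_Schwarzian. fold f1. fold f2.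
  specialize (Hne z Hz). rewrite Cmod_div by exact Hne.
  rewrite <- Hq, Cmod_mult.
  assert (Hp : 0 < Cmod (f1 z)) by now apply Cmod_gt_0.
  replace ((1 - Cmod z ^ 2) * (Cmod z * Cmod (q z) / Cmod (f1 z)))
    with ((Cmod z * ((1 - Cmod z ^ 2) * Cmod (q z))) / Cmod (f1 z)) by (field; lra).
  apply Rle_div_l; [exact Hp|].
  pose proof (Cmod_ge_0 z). unfold Defs.disc in Hz.
  assert (0 <= c * Cmod (f1 z)) by (apply Rmult_le_pos; lra).
  replace (2 * (1 - beta) * cos alpha) with (2 * c) by (unfold c; ring).
  apply Rle_trans with (Cmod z * (2 * c * Cmod (f1 z))).
  - apply Rmult_le_compat_l; lra.
  - nra.
Qed.

(** * The extremal functions *)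

(** Power series solution of [(1 - z^2) f'' = 2 kappa z f'] with [f (0) = 0] and
    [f' (0) = 1], so that [f' (z) = (1 - z^2)^(- kappa)]. *)
Fixpoint extremal_coef (kappa : C) (n : nat) : C :=
  match n with
  | 0 => RtoC 0
  | S m =>
      match m with
      | 0 => RtoC 1
      | S p =>
          (RtoC (INR p) * (RtoC (INR p) - 1 + 2 * kappa) /
             (RtoC (INR (S m)) * RtoC (INR m)) * extremal_coef kappa p)%C
      end
  end.

Lemma extremal_coef_SS kappa p :
  extremal_coef kappa (S (S p)) =
  (RtoC (INR p) * (RtoC (INR p) - 1 + 2 * kappa) /
     (RtoC (INR (S (S p))) * RtoC (INR (S p))) * extremal_coef kappa p)%C.
Proof. reflexivity. Qed.

Lemma INR_S_neq_0 n : RtoC (INR (S n)) <> RtoC 0.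
Proof. intros H. apply (not_0_INR (S n)); [lia|]. now apply RtoC_inj. Qed.

(** For [p >= 1] the recursion factor is at most [p (p + 1) / ((p + 2) (p + 1)) < 1];
    for [p = 0] it is [0]. *)
Lemma extremal_coef_bound kappa n : Cmod kappa <= 1 -> Cmod (extremal_coef kappa n) <= 1.
Proof.
  intros Hk.
  assert (H : Cmod (extremal_coef kappa n) <= 1 /\ Cmod (extremal_coef kappa (S n)) <= 1).
  { induction n as [|p [IH1 IH2]].
    - simpl. rewrite Cmod_0, Cmod_1. lra.
    - split; [exact IH2|]. rewrite extremal_coef_SS, Cmod_mult.
      apply Rle_trans with (1 * 1); [|lra].
      apply Rmult_le_compat; try apply Cmod_ge_0; [|exact IH1].
      rewrite Cmod_div by (apply Cmult_neq_0; apply INR_S_neq_0).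
      rewrite !Cmod_mult, !Cmod_R.
      pose proof (pos_INR p) as Hp. pose proof (pos_INR (S p)). pose proof (pos_INR (S (S p))).
      rewrite !Rabs_pos_eq by assumption.
      apply Rle_div_l; [apply Rmult_lt_0_compat; apply lt_0_INR; lia|].
      rewrite Rmult_1_l.
      destruct p as [|p]; [simpl; lra|].
      apply Rmult_le_compat; [exact Hp|apply Cmod_ge_0|rewrite !S_INR; lra|].
      eapply Rle_trans; [apply Cmod_triangle|].
      rewrite <- RtoC_minus, !Cmod_mult, !Cmod_R.
      rewrite !S_INR in *. rewrite !Rabs_pos_eq by (pose proof (pos_INR p); lra). lra. }
  apply H.
Qed.

(** The sum of the series, by choice of a limit. *)
Definition extremal (kappa z : C) : C :=
  epsilon (inhabits (RtoC 0)) (Cps (extremal_coef kappa) z).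

Lemma extremal_Cps kappa z :
  Cmod kappa <= 1 -> Cmod z < 1 -> Cps (extremal_coef kappa) z (extremal kappa z).
Proof.
  intros Hk Hz. unfold extremal. apply epsilon_spec. revert z Hz. apply Cps_on_of_abs. intros s Hs.
  apply (ex_series_le (V := R_CompleteNormedModule) _ (fun n => s ^ n)).
  - intros n. change (Rabs (Cmod (extremal_coef kappa n) * s ^ n) <= s ^ n).
    assert (0 <= s ^ n) by (apply pow_le; lra).
    pose proof (extremal_coef_bound kappa n Hk).
    rewrite Rabs_pos_eq by (apply Rmult_le_pos; [apply Cmod_ge_0|assumption]).
    pose proof (Cmod_ge_0 (extremal_coef kappa n)). nra.
  - apply ex_series_geom. rewrite Rabs_pos_eq; lra.
Qed.

Definition shift (u : nat -> C) (n : nat) : C :=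
  match n with 0 => RtoC 0 | S m => u m end.

Lemma Cps_shift (u : nat -> C) (z l : C) : Cps u z l -> Cps (shift u) z (z * l)%C.
Proof.
  intros H. replace (z * l)%C with (shift u 0 + z * l)%C by (simpl; ring).
  now apply (Cps_S (shift u)).
Qed.

(** The recursion of [extremal_coef] is this equation, read coefficient by
    coefficient. *)
Lemma extremal_ode kappa z :
  Cmod kappa <= 1 -> Cmod z < 1 ->
  ((1 - z * z) * C_derive (C_derive (extremal kappa)) z =
   2 * kappa * z * C_derive (extremal kappa) z)%C.
Proof.
  intros Hk Hz. set (a := extremal_coef kappa).
  assert (H0 : forall w, Cmod w < 1 -> Cps a w (extremal kappa w)).
  { intros w Hw. now apply extremal_Cps. }
  pose proof (Cps_C_derive_0 _ _ H0) as H1.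
  pose proof (Cps_C_derive_0 _ _ H1) as H2.
  specialize (H1 z Hz). specialize (H2 z Hz).
  set (f1 := C_derive (extremal kappa)) in *. set (f2 := C_derive f1 z) in *.
  assert (E : f2 = (2 * kappa * (z * f1 z) + z * (z * f2))%C).
  { eapply Cseries_unique; [exact H2|].
    eapply Cseries_ext.
    2:{ apply Cseries_plus; [apply Cseries_scal, (Cps_shift _ _ _ H1)|].
        apply (Cps_shift _ _ _ (Cps_shift _ _ _ H2)). }
    intros n. cbv beta.
    assert (Ec : (2 * kappa * shift (Cps_deriv a) n + shift (shift (Cps_deriv (Cps_deriv a))) n =
             Cps_deriv (Cps_deriv a) n)%C).
    { destruct n as [|[|m]].
      - unfold Cps_deriv, a. rewrite extremal_coef_SS. simpl. field.
        repeat split; intros H; apply RtoC_inj in H; lra.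
      - unfold Cps_deriv, a. rewrite extremal_coef_SS. simpl. field.
        repeat split; intros H; apply RtoC_inj in H; lra.
      - simpl shift. unfold Cps_deriv, a.
        rewrite (extremal_coef_SS kappa (S (S m))).
        set (A := extremal_coef kappa (S (S m))).
        pose proof (INR_S_neq_0 (S (S m))) as N3. pose proof (INR_S_neq_0 (S (S (S m)))) as N4.
        assert (E1 : RtoC (INR (S (S m))) = (RtoC (INR (S m)) + 1)%C) by (rewrite (S_INR (S m)); apply RtoC_plus).
        set (p3 := RtoC (INR (S (S (S m))))) in *. set (p4 := RtoC (INR (S (S (S (S m)))))) in *.
        rewrite E1. field. split; assumption. }
    rewrite <- Ec. ring. }
  rewrite E at 1.
  replace ((1 - z * z) * (2 * kappa * (z * f1 z) + z * (z * f2)))%C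
    with (2 * kappa * z * f1 z + z * z * (f2 - (2 * kappa * (z * f1 z) + z * (z * f2))))%C by ring.
  rewrite <- E. ring.
Qed.

(** Along the segment from [0] to [z] the real part has derivative [0]. *)
Lemma zero_slope_const_Re (g : C -> C) :
  (forall w, Defs.disc w -> exists a0 a2, jet g w a0 (RtoC 0) a2) ->
  forall z, Defs.disc z -> Re (g z) = Re (g (RtoC 0)).
Proof.
  intros H z Hz. unfold Defs.disc in Hz.
  symmetry.
  replace (g z) with (g (RtoC 1 * z)%C) by (f_equal; ring).
  replace (g (RtoC 0)) with (g (RtoC 0 * z)%C) by (f_equal; ring).
  apply (eq_is_derive (V := R_NormedModule) (fun t => Re (g (RtoC t * z)%C)) 0 1); [|lra].
  intros t Ht.
  assert (Htz : Defs.disc (RtoC t * z)).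
  { unfold Defs.disc. rewrite Cmod_mult, Cmod_R, Rabs_pos_eq by lra.
    pose proof (Cmod_ge_0 z). nra. }
  destruct (H _ Htz) as (a0 & a2 & Hj).
  destruct (jet_first_order _ _ _ _ _ Hj) as (L & d & HL & Hd & HK).
  apply is_derive_Reals. intros eps Heps.
  assert (Hp : 0 < Rmin (eps / (L + 1)) d).
  { apply Rmin_pos; [apply Rdiv_lt_0_compat|]; lra. }
  exists (mkposreal _ Hp). intros s Hs Hs1. simpl in Hs1.
  set (h := (RtoC s * z)%C).
  assert (Hsp : 0 < Rabs s) by now apply Rabs_pos_lt.
  assert (Eh : Cmod h = Rabs s * Cmod z) by (unfold h; now rewrite Cmod_mult, Cmod_R).
  assert (Hhs : Cmod h <= Rabs s) by (pose proof (Cmod_ge_0 z); nra).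
  assert (B1 : Rabs s < eps / (L + 1)) by (eapply Rlt_le_trans; [exact Hs1|apply Rmin_l]).
  assert (B2 : Rabs s < d) by (eapply Rlt_le_trans; [exact Hs1|apply Rmin_r]).
  destruct (HK h) as (T & HT & E); [lra|].
  replace (RtoC (t + s) * z)%C with (RtoC t * z + h)%C by (unfold h; rewrite RtoC_plus; ring).
  rewrite E, re_plus, Cplus_0_l, Rminus_0_r.
  replace (Re (g (RtoC t * z)%C) + Re (h * (h * T)) - Re (g (RtoC t * z)%C))
    with (Re (h * (h * T))) by ring.
  unfold Rdiv. rewrite Rabs_mult, Rabs_inv.
  apply Rlt_div_l; [exact Hsp|].
  eapply Rle_lt_trans; [apply re_le_Cmod|]. rewrite !Cmod_mult.
  assert (B3 : Rabs s * (L + 1) < eps) by (apply Rlt_div_r; [lra|exact B1]).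
  pose proof (Cmod_ge_0 h). pose proof (Cmod_ge_0 T).
  apply Rle_lt_trans with (Rabs s * (Rabs s * L)).
  - repeat apply Rmult_le_compat; try assumption. apply Rmult_le_pos; assumption.
  - rewrite (Rmult_comm eps). apply Rmult_lt_compat_l; [exact Hsp|]. nra.
Qed.

(** Constancy of the real part, applied to [g] times the conjugate of the difference
    [g z - g 0], says that the squared modulus of this difference is [0]. *)
Lemma zero_slope_const (g : C -> C) :
  (forall w, Defs.disc w -> exists a0 a2, jet g w a0 (RtoC 0) a2) ->
  forall z, Defs.disc z -> g z = g (RtoC 0).
Proof.
  intros H z Hz. set (d := (g z - g (RtoC 0))%C).
  assert (E : Re (Cconj d * g z) = Re (Cconj d * g (RtoC 0))).
  { apply (zero_slope_const_Re (fun w => Cconj d * g w)%C); [|exact Hz].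
    intros w Hw. destruct (H w Hw) as (a0 & a2 & Hj).
    pose proof (jet_mult _ _ _ _ _ _ _ _ _ (jet_const (Cconj d) w) Hj) as Hm.
    do 2 eexists.
    replace (RtoC 0) with (Cconj d * 0 + 0 * a0)%C by ring. exact Hm. }
  assert (Hd : Cmod d ^ 2 = 0).
  { rewrite <- (re_RtoC (Cmod d ^ 2)), Cmod2_conj.
    replace (d * Cconj d)%C with (Cconj d * g z + - (Cconj d * g (RtoC 0)))%C by (unfold d at 3; ring).
    rewrite re_plus, re_opp, E. ring. }
  assert (Hd0 : d = RtoC 0) by (apply Cmod_eq_0; pose proof (Cmod_ge_0 d); nra).
  replace (g z) with (d + g (RtoC 0))%C by (unfold d; ring). rewrite Hd0. ring.
Qed.

Lemma one_minus_sqr_neq_0 z : Cmod z < 1 -> (1 - z * z)%C <> RtoC 0.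
Proof.
  intros Hz H.
  assert (E : (z * z)%C = RtoC 1) by (replace (z * z)%C with (1 - (1 - z * z))%C by ring; rewrite H; ring).
  apply (f_equal Cmod) in E. rewrite Cmod_mult, Cmod_1 in E.
  pose proof (Cmod_ge_0 z). nra.
Qed.

Lemma extremal_0 kappa : Cmod kappa <= 1 -> extremal kappa (RtoC 0) = RtoC 0.
Proof.
  intros Hk. eapply Cseries_unique; [apply extremal_Cps; [exact Hk|rewrite Cmod_0; lra]|].
  apply (Cps_at_0 (extremal_coef kappa)).
Qed.

Lemma extremal_derive_0 kappa : Cmod kappa <= 1 -> C_derive (extremal kappa) (RtoC 0) = RtoC 1.
Proof.
  intros Hk. eapply Cseries_unique.
  - apply (Cps_C_derive_0 (extremal_coef kappa)); [|rewrite Cmod_0; lra].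
    intros z Hz. now apply extremal_Cps.
  - replace (RtoC 1) with (Cps_deriv (extremal_coef kappa) 0) by (unfold Cps_deriv; simpl; ring).
    apply Cps_at_0.
Qed.

Lemma extremal_analytic kappa : Cmod kappa <= 1 -> analytic_on_disc (extremal kappa).
Proof.
  intros Hk. apply (Cps_analytic (extremal_coef kappa)). intros z Hz. now apply extremal_Cps.
Qed.

(** The parameter [- kappa] gives the reciprocal: by the differential equation, the
    product of the two derivatives has derivative [0], so it is constantly [1]. *)
Lemma extremal_derive_neq_0 kappa z :
  Cmod kappa <= 1 -> Cmod z < 1 -> C_derive (extremal kappa) z <> RtoC 0.
Proof.
  intros Hk Hz H.
  assert (Hk' : Cmod (- kappa) <= 1) by now rewrite Cmod_opp.
  set (f := C_derive (extremal kappa)) in *. set (k := C_derive (extremal (- kappa)%C)).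
  assert (E : (f z * k z = f (RtoC 0) * k (RtoC 0))%C).
  { apply (zero_slope_const (fun w => f w * k w)%C); [|exact Hz].
    intros w Hw.
    destruct (analytic_jet_derive f w (analytic_C_derive _ (extremal_analytic _ Hk)) Hw) as [a2 Ha].
    destruct (analytic_jet_derive k w (analytic_C_derive _ (extremal_analytic _ Hk')) Hw) as [b2 Hb].
    pose proof (jet_mult _ _ _ _ _ _ _ _ _ Ha Hb) as Hm.
    do 2 eexists.
    replace (RtoC 0) with (f w * C_derive k w + C_derive f w * k w)%C; [exact Hm|].
    pose proof (extremal_ode kappa w Hk Hw) as O1. fold f in O1.
    pose proof (extremal_ode (- kappa)%C w Hk' Hw) as O2. fold k in O2.
    pose proof (one_minus_sqr_neq_0 w Hw) as N.
    replace (f w * C_derive k w + C_derive f w * k w)%C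
      with ((f w * ((1 - w * w) * C_derive k w) + (1 - w * w) * C_derive f w * k w) / (1 - w * w))%C
      by (field; exact N).
    rewrite O1, O2. field. exact N. }
  unfold f, k in E. rewrite !extremal_derive_0 in E by assumption. fold f k in E.
  rewrite H in E. rewrite Cmult_0_l, Cmult_1_l in E. apply RtoC_inj in E. lra.
Qed.

Lemma extremal_pre_Schwarzian kappa z :
  Cmod kappa <= 1 -> Cmod z < 1 ->
  pre_Schwarzian (extremal kappa) z = (2 * kappa * z / (1 - z * z))%C.
Proof.
  intros Hk Hz. unfold pre_Schwarzian.
  pose proof (extremal_ode kappa z Hk Hz) as O.
  pose proof (extremal_derive_neq_0 kappa z Hk Hz) as N.
  pose proof (one_minus_sqr_neq_0 z Hz) as N'.
  set (f1 := C_derive (extremal kappa)) in *.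
  replace (C_derive f1 z) with (((1 - z * z) * C_derive f1 z) / (1 - z * z))%C by (field; exact N').
  rewrite O. field. split; assumption.
Qed.

(** The quotient [v] satisfies [v = w (v + 2)], so it is closer to [0] than to [- 2]. *)
Lemma cayley_Re (w : C) : Cmod w < 1 -> -1 < Re (2 * w / (1 - w)).
Proof.
  intros Hw.
  assert (N : (1 - w)%C <> RtoC 0).
  { intros H. assert (E : w = RtoC 1) by (replace w with (1 - (1 - w))%C by ring; rewrite H; ring).
    rewrite E, Cmod_1 in Hw. lra. }
  set (v := (2 * w / (1 - w))%C).
  assert (E : v = (w * (v + 2))%C) by (unfold v; field; exact N).
  assert (Hv : 0 < Cmod (v + 2)).
  { apply Cmod_gt_0. replace (v + 2)%C with (2 * / (1 - w))%C by (unfold v; field; exact N).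
    apply Cmult_neq_0; [intros H; apply RtoC_inj in H; lra|].
    intros H. assert (E1 : ((1 - w) * / (1 - w))%C = RtoC 1) by now apply Cinv_r.
    rewrite H, Cmult_0_r in E1. apply RtoC_inj in E1. lra. }
  assert (Hlt : Cmod v < Cmod (v + 2)) by (rewrite E at 1; rewrite Cmod_mult; nra).
  assert (Hsq : Cmod v ^ 2 < Cmod (v + 2) ^ 2) by (pose proof (Cmod_ge_0 v); simpl; nra).
  rewrite !Cmod2_alt in Hsq. destruct v as [x y]. simpl in *. nra.
Qed.

(** As [e * kappa = c], the tested quantity is [e + c * (2 w / (1 - w))] with
    [w = z^2], and [cayley_Re] bounds its real part below by [cos alpha - c]. *)
Lemma extremal_SP0 (alpha beta : R) :
  - PI / 2 < alpha < PI / 2 -> 0 <= beta < 1 ->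
  SP0 alpha beta (extremal (RtoC ((1 - beta) * cos alpha) * Cconj (cexpi alpha))).
Proof.
  intros Halpha Hbeta. set (c := (1 - beta) * cos alpha).
  set (e := cexpi alpha). set (kappa := (RtoC c * Cconj e)%C).
  pose proof (cos_alpha_pos alpha Halpha) as Hcos.
  pose proof (COS_bound alpha) as Hcos1.
  assert (Hc : 0 < c <= 1) by (unfold c; split; nra).
  assert (Hk : Cmod kappa <= 1).
  { unfold kappa, e. rewrite Cmod_mult, Cmod_R, Cmod_conj, Cmod_cexpi, Rabs_pos_eq; lra. }
  assert (Hek : (e * kappa)%C = RtoC c).
  { unfold kappa. replace (e * (RtoC c * Cconj e))%C with (RtoC c * (e * Cconj e))%C by ring.
    rewrite <- Cmod2_conj. unfold e. rewrite Cmod_cexpi, pow1. ring. }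
  split; [split; [split; [|split]|split]|].
  - now apply extremal_analytic.
  - now apply extremal_0.
  - now apply extremal_derive_0.
  - intros z Hz. now apply extremal_derive_neq_0.
  - intros z Hz. pose proof (extremal_pre_Schwarzian kappa z Hk Hz) as P.
    unfold pre_Schwarzian in P. fold e.
    pose proof (one_minus_sqr_neq_0 z Hz) as N.
    replace (e * (1 + z * C_derive (C_derive (extremal kappa)) z / C_derive (extremal kappa) z))%C
      with (e + RtoC c * (2 * (z * z) / (1 - z * z)))%C.
    2:{ replace (z * C_derive (C_derive (extremal kappa)) z / C_derive (extremal kappa) z)%C
          with (z * (C_derive (C_derive (extremal kappa)) z / C_derive (extremal kappa) z))%C
          by (unfold Cdiv; ring).
        rewrite P, <- Hek. field. exact N. }
    rewrite re_plus, re_scal_l. change (Re e) with (cos alpha).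
    assert (Hzz : Cmod (z * z) < 1).
    { rewrite Cmod_mult. unfold Defs.disc in Hz. pose proof (Cmod_ge_0 z). nra. }
    pose proof (cayley_Re (z * z)%C Hzz) as HC.
    assert (c * -1 < c * Re (2 * (z * z) / (1 - z * z))) by (apply Rmult_lt_compat_l; lra).
    unfold c at 1 in H. lra.
  - pose proof (extremal_ode kappa (RtoC 0) Hk) as O. rewrite Cmod_0 in O. specialize (O Rlt_0_1).
    set (x := C_derive _ _) in *.
    replace x with ((1 - 0 * 0) * x)%C by ring. rewrite O. ring.
Qed.

Lemma pre_Schwarzian_norm_ge (f : C -> C) (M : R) (z : C) :
  Rbar_le (pre_Schwarzian_norm f) (Finite M) -> Defs.disc z ->
  (1 - Cmod z ^ 2) * Cmod (pre_Schwarzian f z) <= M.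
Proof.
  intros HM Hz.
  change (Rbar_le (Finite ((1 - Cmod z ^ 2) * Cmod (pre_Schwarzian f z))) (Finite M)).
  eapply Rbar_le_trans; [|exact HM].
  apply (proj1 (Lub_Rbar_correct _)). exists z. now split.
Qed.

Lemma pre_Schwarzian_norm_le (f : C -> C) (M : R) :
  (forall z, Defs.disc z -> (1 - Cmod z ^ 2) * Cmod (pre_Schwarzian f z) <= M) ->
  Rbar_le (pre_Schwarzian_norm f) (Finite M).
Proof.
  intros H. apply (proj2 (Lub_Rbar_correct _)). intros x (z & Hz & ->). now apply H.
Qed.

Theorem theorem2p3 :
  forall alpha beta : R,
    - PI / 2 < alpha < PI / 2 ->
    0 <= beta < 1 ->
    (forall f : C -> C, SP0 alpha beta f ->
       Rbar_le (pre_Schwarzian_norm f)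
               (Finite (2 * (1 - beta) * cos alpha)))
    /\
    (forall M : R,
       (forall f : C -> C, SP0 alpha beta f ->
          Rbar_le (pre_Schwarzian_norm f) (Finite M)) ->
       2 * (1 - beta) * cos alpha <= M).
Proof.
  intros alpha beta Halpha Hbeta. split.
  - intros f Hf. apply pre_Schwarzian_norm_le. intros z Hz.
    now apply SP0_pre_Schwarzian_bound.
  - intros M HM.
    set (c := (1 - beta) * cos alpha).
    set (kappa := (RtoC c * Cconj (cexpi alpha))%C).
    pose proof (cos_alpha_pos alpha Halpha) as Hcos.
    pose proof (COS_bound alpha) as Hcos1.
    assert (Hc : 0 < c <= 1) by (unfold c; split; nra).
    assert (Hk : Cmod kappa = c).
    { unfold kappa. rewrite Cmod_mult, Cmod_R, Cmod_conj, Cmod_cexpi, Rabs_pos_eq; lra. }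
    specialize (HM _ (extremal_SP0 alpha beta Halpha Hbeta)). fold c kappa in HM.
    assert (Hx : forall x, 0 <= x < 1 -> 2 * c * x <= M).
    { intros x Hx.
      assert (Ex : Cmod (RtoC x) = x) by (rewrite Cmod_R; apply Rabs_pos_eq; lra).
      assert (Hd : Cmod (RtoC x) < 1) by lra.
      pose proof (pre_Schwarzian_norm_ge _ _ _ HM Hd) as H.
      rewrite extremal_pre_Schwarzian in H by (try exact Hd; lra).
      rewrite Cmod_div in H by now apply one_minus_sqr_neq_0.
      rewrite <- RtoC_mult, <- RtoC_minus, !Cmod_mult, Hk, !Cmod_R in H.
      rewrite !Rabs_pos_eq in H by nra.
      replace (2 * c * x) with ((1 - x ^ 2) * (2 * c * x / (1 - x * x))) by (field; nra).
      exact H. }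
    replace (2 * (1 - beta) * cos alpha) with (2 * c) by (unfold c; ring).
    apply Rnot_lt_le. intros Hlt.
    (* At this radius the bound 2 c x reaches the midpoint of M and 2 c, which
       exceeds M. *)
    specialize (Hx (Rmax 0 ((M + 2 * c) / (4 * c)))).
    assert (H1 : (M + 2 * c) / (4 * c) < 1) by (apply Rlt_div_l; lra).
    assert (H2 : 0 <= Rmax 0 ((M + 2 * c) / (4 * c)) < 1).
    { split; [apply Rmax_l|apply Rmax_lub_lt; lra]. }
    specialize (Hx H2).
    assert (H3 : (M + 2 * c) / 2 <= 2 * c * Rmax 0 ((M + 2 * c) / (4 * c))).
    { replace ((M + 2 * c) / 2) with (2 * c * ((M + 2 * c) / (4 * c))) by (field; lra).
      apply Rmult_le_compat_l; [lra|apply Rmax_r]. }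
    lra.
Qed.
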